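(* Consider a noisy random unitary circuit on $n$ qubits consisting of $D$ parallel layers of two-qubit gates. There is a constant $\Gamma>0$ such that for any bit strings $\mathbf z,\mathbf z'\in\{0,1\}^n$ with $\mathbf z\ne\mathbf z'$, the corresponding initial quantum states $\rho=|\mathbf z\rangle\langle\mathbf z|$ and $\sigma=|\mathbf z'\rangle\langle\mathbf z'|$ satisfy $$\frac12\,\mathbb E_{\mathcal B}\,\|\mathcal C(\rho-\sigma)\|_1\ \ge\ e^{-\Gamma D},$$ where $\mathcal C$ is the noisy random circuit channel and $\mathbb E_{\mathcal B}$ denotes the expectation over the random two-qubit unitaries.
   Context: An architecture is an arrangement of two-qubit gates without specifying the gate operations. It is parallel if it can be divided into layers such that each qubit is involved in exactly one gate per layer; the number $D$ of layers is the parallel depth. In the noisy architecture each gate is followed by a two-qubit noise channel (CPTP map) acting on the same two qubits; this channel is the same for all gates (homogeneous), independent of the gate unitaries, and symmetric under swapping the two qubits. A noisy random circuit is the ensemble obtained from a noisy architecture by drawing the gate unitaries independently from the Haar measure on two-qubit unitaries ($\mathcal B$ denotes this distribution). The channel $\mathcal C$ is the composition, in order, of all the maps (gate unitary conjugation followed by its noise channel). ''Constant'' means that $\Gamma$ depends only on the two-qubit noise channel and not on $n$, $D$, the architecture, $\mathbf z$ or $\mathbf z'$. $\|\cdot\|_1$ is the trace norm.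
   Formalization: The formal theorem additionally assumes that the one-qubit reduced output of the two-qubit noise channel depends on its input state; without this the claim fails, e.g. complete depolarization gives C(ρ−σ)=0 for D≥1. *)

(* Defs.v *)
From HB Require Import structures.
From mathcomp Require Import all_boot all_order all_algebra.
From mathcomp Require Import spectral sesquilinear complex.
From mathcomp Require Import all_classical all_reals all_analysis.

Set Implicit Arguments.
Unset Strict Implicit.
Unset Printing Implicit Defensive.

Import Order.TTheory GRing.Theory Num.Theory.
Import numFieldNormedType.Exports.

Local Open Scope classical_set_scope.
Local Open Scope ring_scope.
Local Open Scope sesquilinear_scope.

(* Operators on the Hilbert space with orthonormal basis X: matrices whose rows
   and columns are indexed by X through its enumeration. *)
Definition op (R : realType) (X : finType) := 'M[R[i]]_#|X|.

Definition entry (R : realType) (X : finType) (A : op R X) (x y : X) : R[i] :=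
  A (enum_rank x) (enum_rank y).

Definition mkop (R : realType) (X : finType) (F : X -> X -> R[i]) : op R X :=
  \matrix_(i, j) F (enum_val i) (enum_val j).

Definition bits (n : nat) := {ffun 'I_n -> bool}.

Definition qop (R : realType) (n : nat) := op R (bits n).

Definition ketbra (R : realType) (n : nat) (z : bits n) : qop R n :=
  delta_mx (enum_rank z) (enum_rank z).

Definition psd (C : numClosedFieldType) (n : nat) (A : 'M[C]_n) : Prop :=
  forall v : 'rV[C]_n, 0 <= (v *m A *m v ^t*) 0 0.

Definition density (R : realType) (n : nat) (A : qop R n) : Prop :=
  psd A /\ \tr A = 1.

(* The sum of the singular values of A, i.e. the trace of the square root of
   A^* A, whose eigenvalues are the entries of the spectral diagonal. *)
Definition trace_norm (R : realType) (n : nat) (A : 'M[R[i]]_n) : R :=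
  \sum_(i < n) Num.sqrt (complex.Re (spectral_diag (A ^t* *m A) 0 i)).

(* id_K (x) N, acting on an arbitrary ancilla K and two qubits. *)
Definition ampliation (R : realType) (K : finType) (N : qop R 2 -> qop R 2)
    (A : op R (K * bits 2)%type) : op R (K * bits 2)%type :=
  mkop (fun x y =>
    entry (N (mkop (fun u v => entry A (x.1, u) (y.1, v)))) x.2 y.2).

Definition completely_positive (R : realType) (N : qop R 2 -> qop R 2) : Prop :=
  forall (k : nat) (A : op R ('I_k * bits 2)%type),
    psd A -> psd (ampliation N A).

Definition trace_preserving (R : realType) (N : qop R 2 -> qop R 2) : Prop :=
  forall A : qop R 2, \tr (N A) = \tr A.

(* A -> S A S, with S the unitary exchanging the two qubits. *)
Definition swap_conj (R : realType) (A : qop R 2) : qop R 2 :=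
  let s (u : bits 2) : bits 2 := [ffun k => u (rev_ord k)] in
  mkop (fun u v => entry A (s u) (s v)).

Definition swap_symmetric (R : realType) (N : qop R 2 -> qop R 2) : Prop :=
  forall A : qop R 2, N (swap_conj A) = swap_conj (N A).

Definition ptrace2 (R : realType) (A : qop R 2) : op R bool :=
  let pair (b c : bool) : bits 2 := [ffun k => if k == 0 then b else c] in
  mkop (fun b b' => \sum_(c : bool) entry A (pair b c) (pair b' c)).

(* The reduced one-qubit output state depends on the two-qubit input state.  For
   a channel without this property (e.g. complete depolarization) a lower bound
   on distinguishability that is exponential in the depth, uniformly in n and in
   the architecture, can fail.  For a swap-symmetric channel it does not matter which qubit is traced
   out. *)
Definition retains_local_information (R : realType)
    (N : qop R 2 -> qop R 2) : Prop :=
  exists rho sigma : qop R 2,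
    [/\ density rho, density sigma & ptrace2 (N rho) <> ptrace2 (N sigma)].

(* N (x) id, with the first and second qubits of N placed at positions a <> b of
   the register. *)
Definition on_pair (R : realType) (n : nat) (N : qop R 2 -> qop R 2)
    (ab : 'I_n * 'I_n) (A : qop R n) : qop R n :=
  let put (x : bits n) (u : bits 2) : bits n :=
    [ffun i => if i == ab.1 then u 0 else if i == ab.2 then u 1 else x i] in
  let get (x : bits n) : bits 2 :=
    [ffun k => if k == 0 then x ab.1 else x ab.2] in
  mkop (fun x y =>
    entry (N (mkop (fun u v => entry A (put x u) (put y v)))) (get x) (get y)).

(* D layers of m gates each, the k-th gate of layer t acting on the two qubits
   listed in gates t k; each qubit is in exactly one gate per layer, so n = 2m
   as soon as D > 0. *)
Definition parallel (n D m : nat) (gates : 'I_D -> 'I_m -> 'I_n * 'I_n) : Prop :=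
  forall t : 'I_D,
    (forall k : 'I_m, (gates t k).1 <> (gates t k).2) /\
    (forall q : 'I_n, exists! k : 'I_m,
       q = (gates t k).1 \/ q = (gates t k).2).

Definition noisy_gate (R : realType) (N : qop R 2 -> qop R 2) (U : qop R 2)
    (A : qop R 2) : qop R 2 := N (U *m A *m U ^t*).

Definition noisy_circuit (R : realType) (N : qop R 2 -> qop R 2) (n D m : nat)
    (gates : 'I_D -> 'I_m -> 'I_n * 'I_n) (U : 'I_D * 'I_m -> qop R 2)
    (A : qop R n) : qop R n :=
  foldl (fun B t =>
    foldl (fun B' k => on_pair (noisy_gate N (U (t, k))) (gates t k) B')
      B (enum 'I_m))
    A (enum 'I_D).

(* These sets generate the Borel sigma-algebra of the space of two-qubit
   operators, C^(4x4) seen as R^32. *)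
Definition coordinate_sets (R : realType) : set (set (qop R 2)) :=
  [set B | exists (i j : 'I_#|bits 2|) (Y : set R), measurable Y /\
     (B = [set A : qop R 2 | Y (complex.Re (A i j))] \/
      B = [set A : qop R 2 | Y (complex.Im (A i j))])].

HB.instance Definition _ (R : realType) := Choice.on (qop R 2).
HB.instance Definition _ (R : realType) := isPointed.Build (qop R 2) 0.

Definition gate_space (R : realType) := g_sigma_algebraType (@coordinate_sets R).

(* The Haar probability measure on the two-qubit unitary group, as a measure on
   all two-qubit operators that is carried by the unitary ones. *)
Definition is_haar (R : realType)
    (mu : probability (gate_space R) R) : Prop :=
  mu [set W : gate_space R | (W : qop R 2) \is unitarymx] = 1%E /\
  forall (V : qop R 2) (B : set (gate_space R)),
    V \is unitarymx -> measurable B ->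
    mu [set W : gate_space R | B (V *m (W : qop R 2))] = mu B /\
    mu [set W : gate_space R | B ((W : qop R 2) *m V)] = mu B.

Definition mutually_independent (R : realType) (d d' : measure_display)
    (Omega : measurableType d) (T : measurableType d') (P : probability Omega R)
    (I : finType) (X : I -> {RV P >-> T}) : Prop :=
  forall (J : {set I}) (B : I -> set T), (forall i, measurable (B i)) ->
    P [set w | forall i, i \in J -> B i (X i w)] =
    (\prod_(i in J) P (X i @^-1` B i))%E.

(* Main.v *)
(* Fix a qubit q at which z and z' differ and follow the reduction of the evolving
   operator to q, measured by the sum of the moduli of its entries; up to a
   constant this is a lower bound for the trace norm.  In each layer q meets one
   gate, whose noise channel N maps the reduction B of the current operator to
   the two qubits involved to the new reduction to q, namely to the partial trace
   of N (W B W^* ), where W is the Haar distributed gate.  Some entry ell of this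
   partial trace, as a linear functional, does not vanish on traceless matrices,
   because N retains local information.  Since conjugation by unitaries acts
   irreducibly on traceless matrices, there are finitely many unitaries V_1, ...,
   V_k and a constant c with |X| <= c sum_i |ell (V_i X V_i^* )| for all traceless
   X.  The joint law of the gates is invariant under W -> V_i W, so the expected
   norm of the reduction decreases in each layer by at most a constant factor. *)

From HB Require Import structures.
Require Import Defs.
From mathcomp Require Import all_boot all_order all_algebra.
From mathcomp Require Import spectral sesquilinear complex.
From mathcomp Require Import all_classical all_reals all_analysis.
From mathcomp Require Import measurable_realfun.
From mathcomp Require Import ring lra.
Import Order.TTheory GRing.Theory Num.Theory.
Import numFieldNormedType.Exports.
Local Open Scope classical_set_scope.
Local Open Scope ring_scope.
Local Open Scope sesquilinear_scope.
Set Implicit Arguments.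
Unset Strict Implicit.
Unset Printing Implicit Defensive.

(** * The modulus and the trace norm *)

Section modulus.
Variable R : realType.
Implicit Types z w : R[i].

Definition modc z : R := complex.Re `|z|.

Lemma modcE z : (modc z)%:C%C = `|z|.
Proof. by rewrite /modc normc_def. Qed.

Lemma modc_ge0 z : 0 <= modc z.
Proof. by rewrite /modc normc_def sqrtr_ge0. Qed.

Lemma modcM z w : modc (z * w) = modc z * modc w.
Proof. by apply: complexI; rewrite rmorphM/= !modcE normrM. Qed.

Lemma modcD z w : modc (z + w) <= modc z + modc w.
Proof. by rewrite -lecR rmorphD/= !modcE ler_normD. Qed.

Lemma modcN z : modc (- z) = modc z.
Proof. by rewrite /modc normrN. Qed.

Lemma modc_sum (I : Type) (s : seq I) (Q : pred I) (F : I -> R[i]) :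
  modc (\sum_(i <- s | Q i) F i) <= \sum_(i <- s | Q i) modc (F i).
Proof.
rewrite -lecR modcE rmorph_sum/=.
by under [leRHS]eq_bigr do rewrite modcE; exact: ler_norm_sum.
Qed.

Lemma modc0 : modc 0 = 0.
Proof. by rewrite /modc normr0. Qed.

Lemma modc1 : modc 1 = 1.
Proof. by rewrite /modc normr1. Qed.

Lemma modc_nat k : modc k%:R = k%:R.
Proof. by apply: complexI; rewrite modcE normr_nat rmorph_nat. Qed.

Lemma modc_conj z : modc z^* = modc z.
Proof. by apply: complexI; rewrite !modcE norm_conjC. Qed.

Lemma modc_sqr z : (modc z ^+ 2)%:C%C = z^* * z.
Proof. by rewrite rmorphXn/= modcE normCK mulrC. Qed.

Lemma modc_def z : modc z = Num.sqrt ((complex.Re z) ^+ 2 + (complex.Im z) ^+ 2).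
Proof. by apply: complexI; rewrite modcE normc_def. Qed.

Lemma unitarymx_row_sqr n (P : 'M[R[i]]_n) k : P \is unitarymx ->
  \sum_i modc (P k i) ^+ 2 = 1.
Proof.
move=> /unitarymxP /matrixP /(_ k k); rewrite !mxE eqxx => PP.
apply: complexI; rewrite rmorph_sum/= rmorph1 -[RHS]PP.
by apply: eq_bigr => i _; rewrite modc_sqr !mxE mulrC.
Qed.

Lemma unitarymx_modc_le1 n (P : 'M[R[i]]_n) k l : P \is unitarymx ->
  modc (P k l) <= 1.
Proof.
move=> /(unitarymx_row_sqr k) P1; rewrite -(@expr_le1 _ 2)// ?modc_ge0// -P1.
by rewrite (bigD1 l)//= lerDl sumr_ge0// => i _; rewrite sqr_ge0.
Qed.

(** Write S for the left side. The squares of a_i - S b_i sum to the sum of the a_i^2 minus S^2,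
    which is therefore nonnegative. *)
Lemma cauchy_schwarz_unit (I : finType) (a b : I -> R) : \sum_i b i ^+ 2 = 1 ->
  \sum_i a i * b i <= Num.sqrt (\sum_i a i ^+ 2).
Proof.
move=> b1; set S := \sum_i a i * b i.
apply: (le_trans (ler_norm _)); rewrite -sqrtr_sqr ler_wsqrtr//.
rewrite -subr_ge0 [X in 0 <= X](_ : _ = \sum_i (a i - S * b i) ^+ 2); last first.
  under [RHS]eq_bigr do rewrite sqrrB exprMn mulrCA -mulrnAr.
  by rewrite big_split/= sumrB -!mulr_sumr b1 sumrMnl -/S; ring.
by rewrite sumr_ge0// => i _; rewrite sqr_ge0.
Qed.

(* With A^* A = P^* diag(d) P, the columns of Q = A P^* have square norms d_k
   and A = Q P, so that Cauchy-Schwarz applies column by column. *)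
Lemma trace_norm_ge n (A : 'M[R[i]]_n) (f : 'I_n -> 'I_n) (s : 'I_n -> R[i]) :
  injective f -> (forall i, modc (s i) <= 1) ->
  modc (\sum_i s i * A i (f i)) <= trace_norm A.
Proof.
move=> finj s1; pose M := A^t* *m A; pose P := spectralmx M.
have Pu : P \is unitarymx := spectral_unitarymx M.
have Mn : M \is normalmx.
  by apply/normalmxP; rewrite /M trmx_mul map_mxM/= trmxCK.
have ME := orthomx_spectralP Mn; rewrite -/P invmx_unitary// in ME.
set d := spectral_diag M in ME.
have PtP : P^t* *m P = 1%:M by rewrite -invmx_unitary// mulVmx ?unitarymx_unit.
have PPt : P *m P^t* = 1%:M by apply/unitarymxP.
pose Q := A *m P^t*.
have QQ : Q^t* *m Q = diag_mx d.
  rewrite /Q trmx_mul map_mxM/= trmxCK -mulmxA (mulmxA (A^t*)) -/M ME.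
  by rewrite !mulmxA PPt mul1mx -mulmxA PPt mulmx1.
have AE : A = Q *m P by rewrite /Q -mulmxA PtP mulmx1.
have dE k : complex.Re (d 0 k) = \sum_i modc (Q i k) ^+ 2.
  apply: (@complexI R); rewrite rmorph_sum/=.
  have /matrixP /(_ k k) := QQ; rewrite !mxE eqxx mulr1n => qq.
  rewrite RRe_real -?qq.
    by apply: eq_bigr => i _; rewrite modc_sqr !mxE.
  apply: rpred_sum => i _; by rewrite !mxE mulrC -normCK rpredX ?normr_real.
have -> : \sum_i s i * A i (f i) = \sum_k \sum_i s i * (Q i k * P k (f i)).
  rewrite exchange_big; apply: eq_bigr => i _; rewrite {1}AE mxE.
  by rewrite mulr_sumr.
apply: (le_trans (modc_sum _ _ _)); rewrite /trace_norm -/M -/d; apply: ler_sum => k _.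
rewrite dE.
apply: le_trans (_ : _ <= \sum_i modc (Q i k) * modc (P k (f i))) _; last first.
  apply: cauchy_schwarz_unit.
  (* An injective self-map of the index set is a permutation, so row k of [P] read along [f] is
     still a unit vector. *)
  rewrite -(unitarymx_row_sqr k Pu) [RHS](reindex_inj finj)/=.
  exact: eq_bigr.
apply: (le_trans (modc_sum _ _ _)); apply: ler_sum => i _.
by rewrite !modcM ler_piMl// mulr_ge0// modc_ge0.
Qed.

End modulus.

(** * Irreducibility of unitary conjugation *)

Section domination.
Variables (R : realType) (n : nat) (L : 'M[R[i]]_n).
Implicit Types (X A V P : 'M[R[i]]_n) (F G : 'M[R[i]]_n -> R).

(** A quantitative form of membership in the span of the unitary orbit of [L], stated for real
    functions so that sums of moduli are covered too. On traceless X, multiples of the identity are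
    invisible. *)
Definition dominated F :=
  exists (Vs : seq 'M[R[i]]_n) (c : R),
    [/\ {in Vs, forall V, V \is unitarymx}, 0 <= c &
        forall X, \tr X = 0 ->
          F X <= c * \sum_(V <- Vs) modc (\tr (L *m (V *m X *m V^t*)))].

Lemma dominated_le F G : (forall X, \tr X = 0 -> F X <= G X) ->
  dominated G -> dominated F.
Proof.
move=> FG [Vs [c [Vu c0 H]]]; exists Vs, c; split => // X X0.
exact: le_trans (FG _ X0) (H _ X0).
Qed.

Lemma dominated0 : dominated (fun=> 0).
Proof. by exists [::], 0; split => // X _; rewrite mul0r. Qed.

Lemma dominatedD F G : dominated F -> dominated G ->
  dominated (fun X => F X + G X).
Proof.
move=> [Vs [c [Vu c0 H]]] [Ws [d [Wu d0 K]]]; exists (Vs ++ Ws), (c + d).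
split=> [V||X X0]; [|exact: addr_ge0|].
  by rewrite mem_cat => /orP[/Vu|/Wu].
apply: (le_trans (lerD (H _ X0) (K _ X0))); rewrite big_cat/=.
set S := \sum_(_ <- Vs) _; set T := \sum_(_ <- Ws) _.
have S0 : 0 <= S by apply: sumr_ge0 => *; exact: modc_ge0.
have T0 : 0 <= T by apply: sumr_ge0 => *; exact: modc_ge0.
by have := mulr_ge0 c0 T0; have := mulr_ge0 d0 S0; lra.
Qed.

Lemma dominatedZ a F : 0 <= a -> dominated F -> dominated (fun X => a * F X).
Proof.
move=> a0 [Vs [c [Vu c0 H]]]; exists Vs, (a * c); split=> [//||X X0].
  exact: mulr_ge0.
by rewrite -mulrA ler_wpM2l// H.
Qed.

Lemma dominated_sum (I : Type) (s : seq I) (F : I -> 'M[R[i]]_n -> R) :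
  (forall i, dominated (F i)) -> dominated (fun X => \sum_(i <- s) F i X).
Proof.
move=> FD; elim: s => [|i s IHs].
  by apply: dominated_le dominated0 => X _; rewrite big_nil.
apply: dominated_le (dominatedD (FD i) IHs) => X _.
by rewrite big_cons.
Qed.

(** Each unitary W of the list becomes W V, and conjugation keeps X traceless. *)
Lemma dominated_conj F V : V \is unitarymx -> dominated F ->
  dominated (fun X => F (V *m X *m V^t*)).
Proof.
move=> Vu [Vs [c [Vsu c0 H]]]; exists [seq W *m V | W <- Vs], c.
split=> // [_ /mapP[W /Vsu Wu ->]|X X0]; first exact: mul_unitarymx.
have VV : V^t* *m V = 1%:M by rewrite -invmx_unitary// mulVmx// unitarymx_unit.
have X1 : \tr (V *m X *m V^t*) = 0 by rewrite mxtrace_mulC mulmxA VV mul1mx.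
rewrite big_map; apply: (le_trans (H _ X1)).
rewrite le_eqVlt; apply/orP; left; apply/eqP; congr (_ * _).
by apply: eq_bigr => W _; rewrite trmx_mul map_mxM/= !mulmxA.
Qed.

(** In effect: up to a multiple of the identity, [A] is a linear combination of unitary conjugates
    of [L]. The inequality avoids carrying coefficients. *)
Definition spanned A := dominated (fun X => modc (\tr (A *m X))).

Lemma spannedL : spanned L.
Proof.
exists [:: 1%:M], 1; split => // [V|X _].
  by rewrite inE => /eqP ->; apply/unitarymxP; rewrite trmx1 map_mx1 mulmx1.
by rewrite big_seq1 mul1r trmx1 map_mx1 mulmx1 mul1mx.
Qed.

Lemma spannedD A B : spanned A -> spanned B -> spanned (A + B).
Proof.
move=> sA sB; apply: dominated_le (dominatedD sA sB) => X _.
by rewrite mulmxDl mxtraceD modcD.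
Qed.

Lemma spannedZ a A : spanned A -> spanned (a *: A).
Proof.
move=> sA; apply: dominated_le (dominatedZ (modc_ge0 a) sA) => X _.
by rewrite -scalemxAl mxtraceZ modcM.
Qed.

Lemma spannedB A B : spanned A -> spanned B -> spanned (A - B).
Proof. by move=> sA sB; rewrite -scaleN1r; apply/spannedD/spannedZ. Qed.

Lemma spanned_conj A V : V \is unitarymx -> spanned A ->
  spanned (V^t* *m A *m V).
Proof.
move=> Vu sA; apply: dominated_le (dominated_conj Vu sA) => X _.
by rewrite -!mulmxA mxtrace_mulC !mulmxA.
Qed.

(* Conjugating by the unitary (1 - P) + t P multiplies the block P A (1 - P)
   by t^*; averaging over the fourth roots of unity t isolates this block. *)
Lemma spanned_block A P : P *m P = P -> P^t* = P -> spanned A ->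
  spanned (P *m A *m (1%:M - P)).
Proof.
move=> PP Ph sA; set Q := 1%:M - P.
have PQ : P *m Q = 0 by rewrite mulmxBr mulmx1 PP subrr.
have QP : Q *m P = 0 by rewrite mulmxBl mul1mx PP subrr.
have QQ : Q *m Q = Q by rewrite {1}/Q mulmxBl mul1mx PQ subr0.
have Qh : Q^t* = Q by rewrite /Q linearB/= map_mxB/= Ph trmx1 map_mx1.
have QP1 : Q + P = 1%:M by rewrite subrK.
clearbody Q; pose V t := Q + t *: P.
have Vh t : (V t)^t* = Q + t^* *: P.
  by rewrite /V linearD/= map_mxD/= linearZ/= map_mxZ/= Ph Qh.
have Vu t : t * t^* = 1 -> V t \is unitarymx.
  move=> t1; apply/unitarymxP; rewrite Vh /V mulmxDl !mulmxDr.
  rewrite -!scalemxAl -!scalemxAr PQ QP QQ PP !scaler0 addr0 add0r scalerA t1.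
  by rewrite scale1r.
pose W t := (V t)^t* *m A *m V t.
have sW t : t * t^* = 1 -> spanned (W t) by move=> t1; apply/spanned_conj/sA/Vu.
have WE t : t * t^* = 1 -> W t = (Q *m A *m Q + P *m A *m P)
    + t *: (Q *m A *m P) + t^* *: (P *m A *m Q).
  move=> t1; rewrite /W Vh /V mulmxDl mulmxDl !mulmxDr -!scalemxAl -!scalemxAr.
  rewrite scalerA [t^* * t]mulrC t1 scale1r.
  move: (Q *m A *m Q) (Q *m A *m P) (P *m A *m Q) (P *m A *m P) => a b c e.
  by apply/matrixP => k l; rewrite !mxE; ring.
have i1 : 'i * ('i)^* = 1 :> R[i] by rewrite -normCK normCi expr1n.
have -> : P *m A *m Q = (4^-1 : R[i]) *:
    ((W 1 - W (-1)) + 'i *: (W 'i - W (- 'i))).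
  rewrite !WE ?rmorphN ?rmorph1 ?mulrNN ?mulr1//=.
  rewrite conjCi.
  move: (Q *m A *m Q) (Q *m A *m P) (P *m A *m Q) (P *m A *m P) => a b c e.
  have i2 : 'i * 'i = -1 :> R[i] by rewrite -expr2 sqrCi.
  apply/matrixP => k l; rewrite !mxE.
  transitivity (4^-1 * (2 * b k l + 2 * c k l
    + ('i * 'i) * (2 * b k l - 2 * c k l))); last by ring.
  by rewrite i2; field.
by apply/spannedZ/spannedD; [|apply: spannedZ]; apply: spannedB; apply: sW;
  rewrite ?rmorphN ?rmorph1 ?mulrNN ?mulr1.
Qed.


Lemma delta_proj (i : 'I_n) : (delta_mx i i : 'M[R[i]]_n) *m delta_mx i i = delta_mx i i.
Proof. exact: mul_delta_mx. Qed.

Lemma delta_herm (i : 'I_n) : (delta_mx i i : 'M[R[i]]_n)^t* = delta_mx i i.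
Proof. by rewrite trmx_delta map_delta_mx. Qed.

Lemma mulmx_deltas A (i j : 'I_n) :
  delta_mx i i *m A *m delta_mx j j = A i j *: delta_mx i j.
Proof.
rewrite -(mul_delta_mx (0 : 'I_1) i i) -(mul_delta_mx (0 : 'I_1) j j).
rewrite -!mulmxA (mulmxA A) (mulmxA (delta_mx (0 : 'I_1) i)) -colE -rowE.
rewrite [row _ _]mx11_scalar !mxE mul_scalar_mx -scalemxAr.
by rewrite mul_delta_mx.
Qed.

(** Two block extractions isolate a nonzero off-diagonal entry: the projection onto e_i keeps row i
    off the diagonal, then the projection orthogonal to e_j keeps column j. *)
Lemma spanned_delta A (i j : 'I_n) : i != j -> A i j != 0 -> spanned A ->
  spanned (delta_mx i j).
Proof.
move=> ij Aij sA.
have sB := spanned_block (delta_proj i) (delta_herm i) sA.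
pose Q : 'M[R[i]]_n := 1%:M - delta_mx j j.
have QQ : Q *m Q = Q.
  by rewrite {1}/Q mulmxBl mul1mx mulmxBr mulmx1 delta_proj subrr subr0.
have Qh : Q^t* = Q by rewrite /Q linearB/= map_mxB/= delta_herm trmx1 map_mx1.
have := spanned_block QQ Qh sB; rewrite opprB addrCA subrr addr0.
set M := _ *m _ *m _.
have -> : M = A i j *: delta_mx i j.
  have QE : Q *m delta_mx i i = delta_mx i i.
    by rewrite mulmxBl mul1mx mul_delta_mx_0 ?subr0// eq_sym.
  rewrite /M !mulmxA QE -mulmxA mulmxBl mul1mx mul_delta_mx_0// subr0.
  exact: mulmx_deltas.
move=> /(spannedZ (A i j)^-1); rewrite scalerA mulVf// scale1r; exact.
Qed.

(* The orthogonal projection onto the line spanned by e_i + e_j. *)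
Definition mean_proj (i j : 'I_n) : 'M[R[i]]_n := \matrix_(k, l)
  (2^-1 * ((k == i)%:R + (k == j)%:R) * ((l == i)%:R + (l == j)%:R)).

Lemma sum_delta2 (i j : 'I_n) (g : 'I_n -> R[i]) :
  \sum_k ((k == i)%:R + (k == j)%:R) * g k = g i + g j.
Proof.
under eq_bigr do rewrite mulrDl; rewrite big_split/=; congr (_ + _).
  by rewrite (bigD1 i)//= eqxx mul1r big1 ?addr0// => k /negPf ->; rewrite mul0r.
by rewrite (bigD1 j)//= eqxx mul1r big1 ?addr0// => k /negPf ->; rewrite mul0r.
Qed.

Lemma mean_projL (i j : 'I_n) A k l : (mean_proj i j *m A) k l =
  2^-1 * ((k == i)%:R + (k == j)%:R) * (A i l + A j l).
Proof.
by rewrite mxE -(sum_delta2 i j (A^~ l)) mulr_sumr; apply: eq_bigr => x _; rewrite mxE mulrA.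
Qed.

Lemma mean_projR (i j : 'I_n) A k l : (A *m mean_proj i j) k l =
  2^-1 * ((l == i)%:R + (l == j)%:R) * (A k i + A k j).
Proof.
rewrite mxE -(sum_delta2 i j (A k)) mulr_sumr; apply: eq_bigr => x _; rewrite mxE.
by ring.
Qed.

Lemma mean_projK (i j : 'I_n) : i != j ->
  mean_proj i j *m mean_proj i j = mean_proj i j.
Proof.
move=> /negPf ij; apply/matrixP => k l; rewrite mean_projL !mxE !eqxx.
by rewrite (eq_sym j i) ij /=; field.
Qed.

Lemma mean_projH (i j : 'I_n) : (mean_proj i j)^t* = mean_proj i j.
Proof.
apply/matrixP => k l; rewrite !mxE !rmorphM !rmorphD/= !conjC_nat.
by rewrite fmorphV/= conjC_nat; ring.
Qed.

(** This block mixes the indices i and j. The moves between matrix units below isolate one nonzero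
    entry of it, or combine it with matrix units. *)
Lemma spanned_mean_block A (i j : 'I_n) : i != j -> spanned A ->
  spanned (mean_proj i j *m A - mean_proj i j *m A *m mean_proj i j).
Proof.
move=> ij sA.
by have := spanned_block (mean_projK ij) (mean_projH i j) sA; rewrite mulmxBr mulmx1.
Qed.

Lemma mean_blockE A (i j k l : 'I_n) :
  (mean_proj i j *m A - mean_proj i j *m A *m mean_proj i j) k l =
  2^-1 * ((k == i)%:R + (k == j)%:R) *
   (A i l + A j l - 2^-1 * ((l == i)%:R + (l == j)%:R) * (A i i + A j i + A i j + A j j)).
Proof.
by rewrite mxE mean_projL mxE mean_projR !mean_projL; ring.
Qed.

(** A nonzero off-diagonal entry of [L] is isolated directly. Otherwise [L] is diagonal with two
    different diagonal entries, and the mean block turns their difference into an off-diagonal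
    entry. *)
Lemma spanned_offdiag : (forall c, L <> c%:M) ->
  exists i j : 'I_n, i != j /\ spanned (delta_mx i j).
Proof.
move=> Lc.
case: (pselect (exists i j : 'I_n, i != j /\ L i j != 0)) => [[i [j [ij Lij]]]|L0].
  by exists i, j; split => //; exact: spanned_delta ij Lij spannedL.
have {}L0 i j : i != j -> L i j = 0.
  by move=> ij; apply/eqP; apply: contra_notT L0 => Lij; exists i, j.
case: (pselect (exists i j : 'I_n, L i i != L j j)) => [[i [j Lij]]|L1]; last first.
  (* A diagonal matrix with constant diagonal is scalar; in dimension zero the scalar may be taken
     to be 0. *)
  exfalso; case: (pselect (exists i : 'I_n, True)) => [[i0 _]|n0]; last first.
    by apply: (Lc 0); apply/matrixP => i; case: n0; exists i.
  apply: (Lc (L i0 i0)); apply/matrixP => i j; rewrite !mxE.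
  have [->|/L0 ->//] := eqVneq i j; rewrite mulr1n.
  by apply/eqP; apply: contra_notT L1 => Lij; exists j, i0.
have ij : i != j by apply: contra_neq Lij => ->.
exists i, j; split => //.
apply: spanned_delta (spanned_mean_block ij spannedL) => //.
have ji : j != i by rewrite eq_sym.
rewrite mean_blockE !eqxx (negPf ji) (negPf ij) (L0 _ _ ij) (L0 _ _ ji)/=.
rewrite [X in X != 0](_ : _ = 4^-1 * (L j j - L i i)); last by field.
by rewrite mulf_neq0 ?invr_eq0 ?pnatr_eq0// subr_eq0 eq_sym.
Qed.

(** Mixing i with k creates the entry 1/2 at (k, j). *)
Lemma spanned_row (i j k : 'I_n) : i != j -> k != j ->
  spanned (delta_mx i j) -> spanned (delta_mx k j).
Proof.
move=> ij kj sA; have [<-//|ik] := eqVneq i k.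
apply: spanned_delta (spanned_mean_block ik sA) => //.
rewrite mean_blockE !mxE !eqxx (eq_sym j i) (eq_sym j k) (eq_sym k i).
rewrite (negPf ij) (negPf kj) (negPf ik)/=.
rewrite [X in X != 0](_ : _ = 2^-1); last by field.
by rewrite invr_eq0 pnatr_eq0.
Qed.

(** Mixing i with j creates the entry -1/4 at (j, i). *)
Lemma spanned_swap (i j : 'I_n) : i != j ->
  spanned (delta_mx i j) -> spanned (delta_mx j i).
Proof.
move=> ij sA; apply: spanned_delta (spanned_mean_block ij sA); first by rewrite eq_sym.
rewrite mean_blockE !mxE !eqxx (eq_sym j i) (negPf ij)/=.
rewrite [X in X != 0](_ : _ = - 4^-1); last by field.
by rewrite oppr_eq0 invr_eq0 pnatr_eq0.
Qed.

(** The mean block of E_ij is (E_ij + E_jj - E_ii - E_ji) / 4, so E_ij - E_ji minus four times this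
    block is E_ii - E_jj. *)
Lemma spanned_diag (i j : 'I_n) : i != j -> spanned (delta_mx i j) ->
  spanned (delta_mx i i - delta_mx j j).
Proof.
move=> ij sA; have sB := spanned_mean_block ij sA.
move: (mean_blockE (delta_mx i j) i j) sB; set B := _ - _ *m _ => BE sB.
have := spannedB (spannedB sA (spanned_swap ij sA)) (spannedZ 4 sB).
congr spanned; clearbody B; apply/matrixP => k l; rewrite !mxE BE !mxE.
rewrite !eqxx (eq_sym j i) (negPf ij) /= -!mulnb !natrM.
by field.
Qed.

Lemma spanned_all_offdiag (i j k l : 'I_n) : i != j -> k != l ->
  spanned (delta_mx i j) -> spanned (delta_mx k l).
Proof.
have col (a b c : 'I_n) : a != b -> a != c -> spanned (delta_mx a b) ->
    spanned (delta_mx a c).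
  move=> ab ac /(spanned_swap ab) sA; apply: spanned_swap; first by rewrite eq_sym.
  by apply: spanned_row sA; rewrite eq_sym.
(* For k = j the row cannot be moved to k while the column is j; transposing first gives E_ji, whose
   column is then moved. *)
move=> ij kl sA; have [kj|kj] := eqVneq k j.
  by rewrite kj in kl *; apply: col (spanned_swap ij sA) => //; rewrite eq_sym.
by apply: col kl (spanned_row ij kj sA).
Qed.

(** Off-diagonal entries come from off-diagonal matrix units. For traceless X, n times X_ii is the
    sum over k of X_ii - X_kk, so the diagonal is controlled by its differences. *)
Lemma dominated_entries : (forall c, L <> c%:M) ->
  dominated (fun X => \sum_i \sum_j modc (X i j)).
Proof.
move=> Lc; have [i0 [j0 [ij0 sA]]] := spanned_offdiag Lc.
have soff k l : k != l -> spanned (delta_mx k l).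
  by move=> kl; exact: spanned_all_offdiag sA.
have trd (k l : 'I_n) X : \tr (delta_mx k l *m X) = X l k.
  rewrite -(mul_delta_mx (0 : 'I_1)) -mulmxA mxtrace_mulC -rowE -colE.
  by rewrite /mxtrace big_ord1 !mxE.
apply: dominated_sum => i; apply: dominated_sum => j.
have [<-|ij] := eqVneq i j; last first.
  rewrite eq_sym in ij; apply: dominated_le (soff _ _ ij) => X _.
  by rewrite trd.
have sdiff k : dominated (fun X => modc (X i i - X k k)).
  have [<-|ik] := eqVneq i k.
    by apply: dominated_le dominated0 => X _; rewrite subrr modc0.
  apply: dominated_le (spanned_diag ik (soff _ _ ik)) => X _.
  by rewrite mulmxBl linearB/= !trd.
apply: dominated_le (dominated_sum (index_enum _) sdiff) => X X0.
apply: le_trans (modc_sum _ _ _); rewrite sumrB -/(mxtrace X) X0 subr0.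
rewrite sumr_const card_ord -mulr_natr modcM modc_nat ler_peMr ?modc_ge0//.
by rewrite ler1n (leq_ltn_trans _ (ltn_ord i)).
Qed.

End domination.

(** * Reduced operators *)

Section operators.
Variables (R : realType) (X : finType).
Implicit Types A B : op R X.

Lemma entry_mkop (F : X -> X -> R[i]) x y : entry (mkop F) x y = F x y.
Proof. by rewrite /entry mxE !enum_rankK. Qed.

Lemma opP A B : (forall x y, entry A x y = entry B x y) -> A = B.
Proof.
move=> AB; apply/matrixP => i j.
by have := AB (enum_val i) (enum_val j); rewrite /entry !enum_valK.
Qed.

Lemma entryB A B x y : entry (A - B) x y = entry A x y - entry B x y.
Proof. by rewrite /entry !mxE. Qed.

Lemma entry_sum (I : Type) (s : seq I) (Q : pred I) (F : I -> op R X) x y :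
  entry (\sum_(i <- s | Q i) F i) x y = \sum_(i <- s | Q i) entry (F i) x y.
Proof. exact: summxE. Qed.

Lemma sum_enum_rank (F : 'I_#|X| -> R[i]) : \sum_i F i = \sum_x F (enum_rank x).
Proof. by rewrite (reindex _ (onW_bij _ (@enum_rank_bij X))). Qed.

Lemma mxtrace_entry A : \tr A = \sum_x entry A x x.
Proof. exact: sum_enum_rank. Qed.

End operators.

Section registers.
Variables (R : realType) (n : nat).
Implicit Types (A : qop R n) (x y : bits n) (u v : bits 2) (ab : 'I_n * 'I_n).
Implicit Types (S : pred 'I_n) (f g : 'I_n -> bool).

(** [put] and [get] are the functions local to [on_pair], named so that its entries can be
    rewritten. *)
Definition put ab x u : bits n :=
  [ffun i => if i == ab.1 then u 0 else if i == ab.2 then u 1 else x i].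

Definition get ab x : bits 2 := [ffun k => if k == 0 then x ab.1 else x ab.2].

Definition slice ab A x y : qop R 2 :=
  mkop (fun u v => entry A (put ab x u) (put ab y v)).

Lemma on_pairE N ab A x y :
  entry (on_pair N ab A) x y = entry (N (slice ab A x y)) (get ab x) (get ab y).
Proof. by rewrite entry_mkop. Qed.

Lemma putK ab x u : ab.1 != ab.2 -> get ab (put ab x u) = u.
Proof.
move=> ab12; apply/ffunP => k; rewrite !ffunE eqxx (eq_sym ab.2) (negPf ab12) eqxx.
by case: eqVneq => [->//|k0]; congr (u _); case: k k0 => -[|[|]]//= *; apply/val_inj.
Qed.

Lemma put_get ab x : put ab x (get ab x) = x.
Proof.
by apply/ffunP => i; rewrite !ffunE /=; case: eqP => [->//|_]; case: eqP => [->|].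
Qed.

Lemma put_put ab x u v : put ab (put ab x u) v = put ab x v.
Proof. by apply/ffunP => i; rewrite !ffunE; case: (i == _) => //; case: (i == _). Qed.

Definition bits0 : bits 2 := [ffun=> false].

(** Each string arises uniquely by writing two bits into a string that is cleared at the pair. *)
Lemma sum_split_pair ab (F : bits n -> R[i]) : ab.1 != ab.2 ->
  \sum_x F x = \sum_(x | get ab x == bits0) \sum_u F (put ab x u).
Proof.
move=> ab12; rewrite (partition_big (fun x => put ab x bits0)
  (fun x => get ab x == bits0)) /=; last by move=> x _; rewrite putK.
apply: eq_bigr => x0 /eqP gx0; rewrite (reindex_onto (put ab x0) (get ab))/=.
  apply: eq_bigl => u; rewrite putK// eqxx andbT put_put.
  by rewrite -{1}gx0 put_get eqxx.
by move=> x /eqP <-; rewrite put_put put_get.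
Qed.

Definition agree S f g x y : bool :=
  [forall i, if S i then (x i == f i) && (y i == g i) else x i == y i].

(* The entry at (f, g) of the reduction of A to the qubits in S: the qubits
   outside S are traced out. *)
Definition marginal S f g A : R[i] :=
  \sum_x \sum_y (agree S f g x y)%:R * entry A x y.

Lemma marginalB S f g A B : marginal S f g (A - B) = marginal S f g A - marginal S f g B.
Proof.
rewrite /marginal -sumrB; apply: eq_bigr => x _; rewrite -sumrB.
by apply: eq_bigr => y _; rewrite entryB mulrBr.
Qed.

Lemma eq_marginal S f g f' g' A : {in S, f =1 f'} -> {in S, g =1 g'} ->
  marginal S f g A = marginal S f' g' A.
Proof.
move=> ff gg; apply: eq_bigr => x _; apply: eq_bigr => y _; congr (_%:R * _).
congr nat_of_bool; apply: eq_forallb => i; case: ifPn => // Si.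
by rewrite ff// gg.
Qed.

(** The trace is the reduction to no qubits; its preservation by a layer thus becomes a case of the
    invariance of marginals. *)
Lemma mxtrace_marginal f g A : \tr A = marginal pred0 f g A.
Proof.
rewrite mxtrace_entry; apply: eq_bigr => x _.
rewrite (bigD1 x)//= big1 => [|y xy]; last first.
  have -> : agree pred0 f g x y = false; last by rewrite mul0r.
  apply: contra_neqF xy => /forallP xy; apply/ffunP => i.
  by apply/esym/eqP; exact: xy.
have -> : agree pred0 f g x x = true by apply/forallP => i /=.
by rewrite mul1r addr0.
Qed.

Definition setbit f (r : 'I_n) (e : bool) : 'I_n -> bool :=
  fun i => if i == r then e else f i.

(** A traced-out qubit r has equal row and column bits, and this common bit selects the only value
    of e that contributes. *)
Lemma marginal_add S f g (r : 'I_n) A : ~~ S r ->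
  marginal S f g A =
  \sum_e marginal (predU1 r S) (setbit f r e) (setbit g r e) A.
Proof.
move=> Sr; rewrite /marginal [RHS]exchange_big; apply: eq_bigr => x _.
rewrite exchange_big; apply: eq_bigr => y _; rewrite -mulr_suml; congr (_ * _).
have agreeE e : agree (predU1 r S) (setbit f r e) (setbit g r e) x y =
    [&& x r == e, y r == e & agree S f g x y].
  apply/forallP/and3P => [H|[/eqP xe /eqP ye /forallP H] i].
    have := H r; rewrite /setbit/= eqxx => /andP[xe ye]; split => //.
    apply/forallP => i; have := H i; rewrite /setbit/=.
    have [->|ir] := eqVneq i r; last by [].
    by rewrite (negPf Sr) => _; rewrite (eqP xe) (eqP ye).
  rewrite /setbit /=; have [->|ir] := eqVneq i r; last exact: H.
  by rewrite xe ye eqxx.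
under eq_bigr do rewrite agreeE.
have [xyr|xyr] := eqVneq (x r) (y r).
  rewrite (bigD1 (x r))//= -xyr eqxx/= big1 ?addr0// => e.
  by rewrite eq_sym => /negPf ->.
have -> : agree S f g x y = false.
  by apply/negbTE/forallPn; exists r; rewrite (negPf Sr).
rewrite big1// => e _; case: eqP => //= xe; case: eqP => //= ye.
Qed.

Lemma agree_put S f g ab x y u v : ab.1 != ab.2 -> ~~ S ab.1 -> ~~ S ab.2 ->
  get ab x = bits0 -> get ab y = bits0 ->
  agree S f g (put ab x u) (put ab y v) = (u == v) && agree S f g x y.
Proof.
move=> ab12 Sa Sb gx gy.
have x0 k : get ab x k = get ab y k by rewrite gx gy.
apply/forallP/andP => [H|[/eqP <- /forallP H] i].
  split; [apply/eqP|apply/forallP => i].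
    rewrite -(putK x u ab12) -(putK y v ab12); apply/ffunP => k.
    rewrite [LHS]ffunE [RHS]ffunE.
    have := H ab.1; have := H ab.2; rewrite (negPf Sa) (negPf Sb) => /eqP Hb /eqP Ha.
    by case: ifP.
  have := H i; rewrite !ffunE; case: (eqVneq i ab.1) => [->|ia].
    by rewrite (negPf Sa) => _; have := x0 0; rewrite !ffunE/= => ->.
  case: (eqVneq i ab.2) => [->|ib] //.
  by rewrite (negPf Sb) => _; have := x0 1; rewrite !ffunE/= => ->.
have := H i; rewrite !ffunE; case: (eqVneq i ab.1) => [->|ia]; first by rewrite (negPf Sa) eqxx.
by case: (eqVneq i ab.2) => [->|//]; rewrite (negPf Sb) eqxx.
Qed.

Lemma slice_put ab A x y u v : slice ab A (put ab x u) (put ab y v) = slice ab A x y.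
Proof. by apply: opP => s t; rewrite !entry_mkop !put_put. Qed.

(** A gate whose two qubits are both traced out enters only through the trace of its output, which N
    preserves. *)
Lemma marginal_on_pair N S f g ab A : trace_preserving N ->
  ab.1 != ab.2 -> ~~ S ab.1 -> ~~ S ab.2 ->
  marginal S f g (on_pair N ab A) = marginal S f g A.
Proof.
move=> Ntp ab12 Sa Sb; rewrite /marginal !(sum_split_pair _ ab12).
apply: eq_bigr => x /eqP gx.
(* Both qubits of the pair are traced out, so only equal settings u on the row and column side
   contribute, leaving a trace over the pair. *)
have splity (B : qop R n) : \sum_u \sum_y (agree S f g (put ab x u) y)%:R * entry B (put ab x u) y =
    \sum_(y | get ab y == bits0) (agree S f g x y)%:R *
       \sum_u entry B (put ab x u) (put ab y u).
  under eq_bigr do rewrite (sum_split_pair _ ab12).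
  rewrite exchange_big; apply: eq_bigr => y /eqP gy.
  rewrite mulr_sumr; apply: eq_bigr => u _; rewrite (bigD1 u)//= big1 => [|v vu].
    by rewrite agree_put// eqxx addr0.
  by rewrite agree_put// eq_sym (negPf vu) mul0r.
rewrite !splity; apply: eq_bigr => y /eqP gy; congr (_ * _).
under eq_bigr do rewrite on_pairE slice_put !putK//.
rewrite -mxtrace_entry Ntp mxtrace_entry.
by under eq_bigr do rewrite entry_mkop.
Qed.

(** The value [false] filled in away from the pair is an arbitrary default: a marginal depends on f
    and g only on the kept qubits. *)
Definition reduce ab A : qop R 2 :=
  mkop (fun u v => marginal [pred i | (i == ab.1) || (i == ab.2)]
    (put ab [ffun=> false] u) (put ab [ffun=> false] v) A).

Lemma agree_reduce ab x y s t u v : ab.1 != ab.2 ->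
  get ab x = bits0 -> get ab y = bits0 ->
  agree [pred i | (i == ab.1) || (i == ab.2)]
    (put ab [ffun=> false] u) (put ab [ffun=> false] v) (put ab x s) (put ab y t)
  = [&& s == u, t == v & x == y].
Proof.
move=> ab12 gx gy; apply/forallP/and3P => [H|[/eqP-> /eqP-> /eqP->] i]; last first.
  rewrite !ffunE /=; case: (eqVneq i ab.1) => [?|ia] /=; first by rewrite !eqxx.
  by case: (eqVneq i ab.2) => [?|ib] /=; rewrite !eqxx.
have H1 := H ab.1; have H2 := H ab.2.
rewrite !ffunE /= !eqxx /= in H1; rewrite !ffunE /= !eqxx /= eq_sym (negPf ab12) /= in H2.
case/andP: H1 => /eqP s0 /eqP t0; case/andP: H2 => /eqP s1 /eqP t1.
have k01 (k : 'I_2) : k = 0 \/ k = 1.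
  by case: k => -[|[|//]] ?; [left|right]; exact/val_inj.
split; apply/eqP/ffunP => i; first by case: (k01 i) => ->.
  by case: (k01 i) => ->.
have x0 k : get ab x k = get ab y k by rewrite gx gy.
have := H i; rewrite !ffunE /=; case: (eqVneq i ab.1) => [->|ia] /=.
  by move=> _; have := x0 0; rewrite !ffunE.
case: (eqVneq i ab.2) => [->|ib /eqP//] /=.
by move=> _; have := x0 1; rewrite !ffunE.
Qed.

Lemma reduceE ab A : ab.1 != ab.2 ->
  reduce ab A = \sum_(x | get ab x == bits0) slice ab A x x.
Proof.
move=> ab12; apply: opP => u v; rewrite entry_mkop entry_sum /marginal.
rewrite (sum_split_pair _ ab12); apply: eq_bigr => x /eqP gx.
rewrite entry_mkop (bigD1 u)//= (sum_split_pair _ ab12) (bigD1 x) ?gx//=.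
rewrite (bigD1 v)//= agree_reduce// !eqxx mul1r !big1 ?addr0//.
- move=> s /negPf su; rewrite (sum_split_pair _ ab12) big1// => y /eqP gy.
  by rewrite big1// => t _; rewrite agree_reduce// su mul0r.
- move=> y /andP[/eqP gy /negPf yx]; rewrite big1// => t _.
  by rewrite agree_reduce// (eq_sym x) yx !andbF mul0r.
- by move=> t /negPf tv; rewrite agree_reduce// tv !andbF mul0r.
Qed.

(** The reduction is a sum of slices and the gate applies N to each slice, so linearity takes N out
    of the sum. *)
Lemma reduce_on_pair (N : {linear qop R 2 -> qop R 2}) ab A : ab.1 != ab.2 ->
  reduce ab (on_pair N ab A) = N (reduce ab A).
Proof.
move=> ab12; rewrite !reduceE// linear_sum; apply: eq_bigr => x _.
by apply: opP => u v; rewrite entry_mkop on_pairE slice_put !putK.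
Qed.

Lemma mxtrace_reduce ab A : ab.1 != ab.2 -> \tr (reduce ab A) = \tr A.
Proof.
move=> ab12; rewrite reduceE// linear_sum/= mxtrace_entry (sum_split_pair _ ab12).
by apply: eq_bigr => x _; rewrite mxtrace_entry; apply: eq_bigr => u _; rewrite entry_mkop.
Qed.

Definition pair_bits (b c : bool) : bits 2 := [ffun k => if k == 0 then b else c].

(** Reducing to q amounts to reducing to the pair and then tracing out r. There are two versions
    because a gate may list q first or second. *)
Lemma marginal1_reduce1 (q r : 'I_n) b c A : q != r ->
  marginal (pred1 q) (fun=> b) (fun=> c) A =
  \sum_e entry (reduce (q, r) A) (pair_bits b e) (pair_bits c e).
Proof.
move=> qr; rewrite (@marginal_add _ _ _ r)/= 1?eq_sym//.
apply: eq_bigr => e _; rewrite entry_mkop.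
transitivity (marginal [pred i | (i == q) || (i == r)]
   (setbit (fun=> b) r e) (setbit (fun=> c) r e) A).
  apply: eq_bigr => x _; apply: eq_bigr => y _; congr (_%:R * _).
  by congr nat_of_bool; apply: eq_forallb => i; rewrite /= orbC.
by apply: eq_marginal => i; rewrite !inE /setbit !ffunE/= => /orP[] /eqP ->;
   rewrite ?eqxx ?(negPf qr)// eq_sym (negPf qr).
Qed.

Lemma marginal1_reduce2 (q r : 'I_n) b c A : q != r ->
  marginal (pred1 q) (fun=> b) (fun=> c) A =
  \sum_e entry (reduce (r, q) A) (pair_bits e b) (pair_bits e c).
Proof.
move=> qr; rewrite (@marginal_add _ _ _ r)/= 1?eq_sym//.
apply: eq_bigr => e _; rewrite entry_mkop.
by apply: eq_marginal => i; rewrite !inE /setbit !ffunE/= => /orP[] /eqP ->;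
   rewrite ?eqxx ?(negPf qr)// eq_sym (negPf qr).
Qed.

(** * The norm of a one-qubit reduction and the trace norm *)

Definition qubit_norm (q : 'I_n) A : R :=
  \sum_b \sum_c modc (marginal (pred1 q) (fun=> b) (fun=> c) A).

Lemma trace_norm_ge_entries A (h : bits n -> bits n) (s : bits n -> R[i]) :
  injective h -> (forall x, modc (s x) <= 1) ->
  modc (\sum_x s x * entry A x (h x)) <= trace_norm A.
Proof.
move=> hinj s1.
have := @trace_norm_ge _ _ A (fun i => enum_rank (h (enum_val i))) (fun i => s (enum_val i)).
rewrite sum_enum_rank; under eq_bigr do rewrite enum_rankK.
by apply => // i j /enum_rank_inj /hinj /enum_val_inj.
Qed.

(** The entry at (b, c) is a 0-1 weighted sum of entries of [A] along a permutation: [h] flips the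
    bit of q exactly when b and c differ. *)
Lemma marginal1_le_trace_norm (q : 'I_n) b c A :
  modc (marginal (pred1 q) (fun=> b) (fun=> c) A) <= trace_norm A.
Proof.
pose h x : bits n := [ffun i => if i == q then x q (+) b (+) c else x i].
have hK : involutive h.
  move=> x; apply/ffunP => i; rewrite !ffunE eqxx; case: eqP => // ->.
  by case: (x q); case: (b); case: (c).
have := @trace_norm_ge_entries A h (fun x => (x q == b)%:R) (inv_inj hK).
rewrite [X in modc X](_ : _ = marginal (pred1 q) (fun=> b) (fun=> c) A).
  by apply => x; rewrite modc_nat lern1 leq_b1.
apply: eq_bigr => x _; rewrite (bigD1 (h x))//= big1 ?addr0 => [|y yh].
  congr (_%:R * _); congr nat_of_bool; apply/idP/forallP => [/eqP xb i|/(_ q)].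
    rewrite /= !ffunE; case: eqP => [->|//].
    by rewrite xb eqxx/= addbb.
  by rewrite /= eqxx => /andP[].
have -> : agree (pred1 q) (fun=> b) (fun=> c) x y = false; last by rewrite mul0r.
apply: contra_neqF yh => /forallP H; apply/ffunP => i; rewrite ffunE.
have := H i; rewrite /=; case: eqP => [->|_ /eqP//].
by move=> /andP[/eqP -> /eqP ->]; rewrite addbb.
Qed.

Lemma qubit_norm_le_trace_norm (q : 'I_n) A : qubit_norm q A <= 4 * trace_norm A.
Proof.
rewrite /qubit_norm !big_bool/=.
have H b c := marginal1_le_trace_norm q b c A.
have := H true true; have := H true false; have := H false true.
by have := H false false; lra.
Qed.

Lemma entry_ketbra z x y : entry (ketbra R z) x y = ((x == z) && (y == z))%:R.
Proof. by rewrite /entry mxE !(inj_eq enum_rank_inj). Qed.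

Lemma marginal_ketbra S f g z :
  marginal S f g (ketbra R z) = (agree S f g z z)%:R.
Proof.
rewrite /marginal (bigD1 z)//= (bigD1 z)//= entry_ketbra !eqxx mulr1.
rewrite !big1 ?addr0// => [x xz|y yz].
  by rewrite big1// => y _; rewrite entry_ketbra (negPf xz) mulr0.
by rewrite entry_ketbra (negPf yz) andbF mulr0.
Qed.

(** At the diagonal position given by the bit z q, the first state contributes 1 and the second
    0. *)
Lemma qubit_norm_ketbra (q : 'I_n) (z z' : bits n) : z q != z' q ->
  1 <= qubit_norm q (ketbra R z - ketbra R z').
Proof.
move=> zq; rewrite /qubit_norm (bigD1 (z q))//= (bigD1 (z q))//=.
rewrite marginalB !marginal_ketbra -addrA.
have -> : agree (pred1 q) (fun=> z q) (fun=> z q) z z = true.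
  by apply/forallP => i /=; case: eqP => [->|_]; rewrite !eqxx.
have -> : agree (pred1 q) (fun=> z q) (fun=> z q) z' z' = false.
  by apply/negbTE/forallPn; exists q; rewrite /= eqxx eq_sym (negPf zq).
rewrite subr0 modc1 lerDl addr_ge0// sumr_ge0// => [c _|b _]; first exact: modc_ge0.
by rewrite sumr_ge0// => *; exact: modc_ge0.
Qed.

(** Used at depth zero, where the constant lost by passing through [qubit_norm] cannot be afforded.
    The signs chosen turn the diagonal sum into 2. *)
Lemma trace_norm_ketbra (z z' : bits n) : z != z' -> 2 <= trace_norm (ketbra R z - ketbra R z').
Proof.
move=> zz'.
have := @trace_norm_ge_entries (ketbra R z - ketbra R z') id
  (fun x => if x == z then 1 else -1) (@inj_id _).
rewrite (bigD1 z)//= (bigD1 z') 1?eq_sym//= big1 => [|x /andP[xz xz']]; last first.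
  by rewrite entryB !entry_ketbra (negPf xz) (negPf xz') subrr mulr0.
rewrite !entryB !entry_ketbra !eqxx (eq_sym z' z) (negPf zz') /=.
rewrite [X in modc X](_ : _ = 2); last by ring.
rewrite modc_nat; apply => x.
by case: ifP; rewrite ?modcN modc1.
Qed.

Lemma mxtrace_ketbra (z : bits n) : \tr (ketbra R z) = 1.
Proof.
rewrite (mxtrace_marginal xpred0 xpred0) marginal_ketbra.
by have -> : agree pred0 xpred0 xpred0 z z = true by apply/forallP => i /=.
Qed.

End registers.

(** * Measurability and the joint law of the gates *)

Lemma linear_mxE (R : realType) m n p q
    (N : {linear 'M[R[i]]_(m, n) -> 'M[R[i]]_(p, q)}) (X : 'M[R[i]]_(m, n)) i j :
  N X i j = \sum_k \sum_l X k l * N (delta_mx k l) i j.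
Proof.
rewrite {1}(matrix_sum_delta X) linear_sum summxE; apply: eq_bigr => k _.
by rewrite linear_sum summxE; apply: eq_bigr => l _; rewrite linearZ mxE.
Qed.

Section complex_measurability.
Variables (R : realType) (d : measure_display) (T : measurableType d).

(** Real and imaginary parts separately, matching the coordinate sets that generate the
    sigma-algebra on gates. *)
Definition cmeasurable (f : T -> R[i]) :=
  measurable_fun setT (fun t => complex.Re (f t)) /\
  measurable_fun setT (fun t => complex.Im (f t)).

Lemma cmeasurable_cst z : cmeasurable (fun=> z).
Proof. by split; exact: measurable_cst. Qed.

Lemma cmeasurableD f g : cmeasurable f -> cmeasurable g ->
  cmeasurable (fun t => f t + g t).
Proof.
move=> [rf imf] [rg img]; split.
  rewrite (_ : (fun _ => _) = (fun t => complex.Re (f t)) \+ (fun t => complex.Re (g t))).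
    exact: measurable_funD.
  by apply/funext => t /=; rewrite raddfD.
rewrite (_ : (fun _ => _) = (fun t => complex.Im (f t)) \+ (fun t => complex.Im (g t))).
  exact: measurable_funD.
by apply/funext => t /=; rewrite raddfD.
Qed.

Lemma cmeasurableM f g : cmeasurable f -> cmeasurable g ->
  cmeasurable (fun t => f t * g t).
Proof.
move=> [rf imf] [rg img]; split.
  rewrite (_ : (fun _ => _) = (fun t => complex.Re (f t)) \* (fun t => complex.Re (g t)) \-
     (fun t => complex.Im (f t)) \* (fun t => complex.Im (g t))).
    by apply: measurable_funB; exact: measurable_funM.
  by apply/funext => t /=; case: (f t) (g t) => [a b] [a' b'].
rewrite (_ : (fun _ => _) = (fun t => complex.Re (f t)) \* (fun t => complex.Im (g t)) \+
   (fun t => complex.Im (f t)) \* (fun t => complex.Re (g t))).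
  by apply: measurable_funD; exact: measurable_funM.
by apply/funext => t /=; case: (f t) (g t) => [a b] [a' b'].
Qed.

Lemma cmeasurable_conj f : cmeasurable f -> cmeasurable (fun t => (f t)^*).
Proof.
move=> [rf imf]; split.
  by rewrite (_ : (fun _ => _) = (fun t => complex.Re (f t)))//;
    apply/funext => t; case: (f t).
rewrite (_ : (fun _ => _) = \- (fun t => complex.Im (f t))).
  exact: measurable_funN.
by apply/funext => t /=; case: (f t).
Qed.

Lemma cmeasurable_sum (I : Type) (s : seq I) (F : I -> T -> R[i]) :
  (forall i, cmeasurable (F i)) -> cmeasurable (fun t => \sum_(i <- s) F i t).
Proof.
move=> mF; elim: s => [|i s IHs].
  by under eq_fun do rewrite big_nil; exact: cmeasurable_cst.
by under eq_fun do rewrite big_cons; exact: cmeasurableD.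
Qed.

Lemma measurable_modc f : cmeasurable f -> measurable_fun setT (fun t => modc (f t)).
Proof.
move=> [rf imf]; pose h t := complex.Re (f t) ^+ 2 + complex.Im (f t) ^+ 2.
rewrite (_ : (fun _ => _) = (@powR R ^~ 2^-1) \o h).
  apply: measurableT_comp; first exact: measurable_powR.
  by apply: measurable_funD; exact: measurable_funX.
by apply/funext => t /=; rewrite modc_def powR12_sqrt// addr_ge0// sqr_ge0.
Qed.

Definition mxmeasurable m n (F : T -> 'M[R[i]]_(m, n)) :=
  forall i j, cmeasurable (fun t => F t i j).

Lemma mxmeasurable_cst m n (A : 'M[R[i]]_(m, n)) : mxmeasurable (fun=> A).
Proof. by move=> i j; exact: cmeasurable_cst. Qed.

Lemma mxmeasurableM m n p (F : T -> 'M[R[i]]_(m, n)) (G : T -> 'M[R[i]]_(n, p)) :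
  mxmeasurable F -> mxmeasurable G -> mxmeasurable (fun t => F t *m G t).
Proof.
move=> mF mG i j; under eq_fun do rewrite mxE.
by apply: cmeasurable_sum => k; exact: cmeasurableM.
Qed.

Lemma mxmeasurable_adj m n (F : T -> 'M[R[i]]_(m, n)) :
  mxmeasurable F -> mxmeasurable (fun t => (F t)^t*).
Proof. by move=> mF i j; under eq_fun do rewrite !mxE; exact: cmeasurable_conj. Qed.

Lemma mxmeasurable_linear m n p q (N : {linear 'M[R[i]]_(m, n) -> 'M[R[i]]_(p, q)})
  (F : T -> 'M[R[i]]_(m, n)) : mxmeasurable F -> mxmeasurable (fun t => N (F t)).
Proof.
move=> mF i j; under eq_fun do rewrite linear_mxE.
apply: cmeasurable_sum => k; apply: cmeasurable_sum => l.
by apply: cmeasurableM => //; exact: cmeasurable_cst.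
Qed.

End complex_measurability.

Section circuit_measurability.
Variables (R : realType) (d : measure_display) (T : measurableType d).
Variables (N : {linear qop R 2 -> qop R 2}) (n : nat).

Lemma mxmeasurable_noisy_on_pair ab (W : T -> qop R 2) (F : T -> qop R n) :
  mxmeasurable W -> mxmeasurable F ->
  mxmeasurable (fun t => on_pair (noisy_gate N (W t)) ab (F t)).
Proof.
move=> mW mF i j; under eq_fun do rewrite mxE.
rewrite /entry /noisy_gate; apply: mxmeasurable_linear.
apply: mxmeasurableM; last exact: mxmeasurable_adj.
apply: mxmeasurableM => // k l; under eq_fun do rewrite mxE.
exact: mF.
Qed.

Lemma cmeasurable_marginal S f g (F : T -> qop R n) :
  mxmeasurable F -> cmeasurable (fun t => marginal S f g (F t)).
Proof.
move=> mF; apply: cmeasurable_sum => x; apply: cmeasurable_sum => y.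
by apply: cmeasurableM; [exact: cmeasurable_cst|exact: mF].
Qed.

Lemma mxmeasurable_reduce ab (F : T -> qop R n) :
  mxmeasurable F -> mxmeasurable (fun t => reduce ab (F t)).
Proof.
by move=> mF i j; under eq_fun do rewrite mxE; exact: cmeasurable_marginal.
Qed.

Lemma measurable_qubit_norm q (F : T -> qop R n) :
  mxmeasurable F -> measurable_fun setT (fun t => qubit_norm q (F t)).
Proof.
move=> mF; apply: measurable_sum => b; apply: measurable_sum => c.
exact/measurable_modc/cmeasurable_marginal.
Qed.

End circuit_measurability.

(* Applied with g the trace norm, whose measurability is thus not an issue. *)
Lemma ge0_le_integral_above d (T : measurableType d) (R : realType)
  (mu : {measure set T -> \bar R}) (f g : T -> \bar R) :
  (forall x, 0 <= f x)%E -> (forall x, f x <= g x)%E ->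
  (\int[mu]_x f x <= \int[mu]_x g x)%E.
Proof.
move=> f0 fg; rewrite !ge0_integralTE => [|x|//]; last exact: le_trans (fg x).
apply: le_ereal_sup => _ [h hf <-]; exists h => // x.
exact: le_trans (hf x) (fg x).
Qed.

(** * Families of independent Haar gates and their invariance under shifting one gate *)

Section haar_gates.
Variables (R : realType) (haar : probability (gate_space R) R).
Hypothesis haarP : is_haar haar.

Lemma measurable_coordinate (i j : 'I_#|bits 2|) (Y : set R) : measurable Y ->
  measurable [set A : gate_space R | Y (complex.Re ((A : qop R 2) i j))] /\
  measurable [set A : gate_space R | Y (complex.Im ((A : qop R 2) i j))].
Proof.
by move=> mY; split; apply: sub_sigma_algebra; exists i, j, Y; split => //; [left|right].
Qed.

Lemma mxmeasurable_gate : mxmeasurable (fun A : gate_space R => (A : qop R 2)).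
Proof.
move=> i j; split => _ Y mY; rewrite setTI.
  by have [] := measurable_coordinate i j mY.
by have [] := measurable_coordinate i j mY.
Qed.

Lemma measurable_gate d (T : measurableType d) (F : T -> gate_space R) :
  mxmeasurable (F : T -> qop R 2) -> measurable_fun setT F.
Proof.
move=> mF.
apply: (@measurability _ _ T (gate_space R) setT F (@coordinate_sets R) erefl).
move=> _ [_ [i [j [Y [mY [->|->]]]]] <-].
  exact: (mF i j).1.
exact: (mF i j).2.
Qed.

Lemma measurable_cpreimage1 d (T : measurableType d) (f : T -> R[i]) z :
  cmeasurable f -> measurable [set t | f t = z].
Proof.
move=> [mr mi]; rewrite (_ : [set t | _] =
  (fun t => complex.Re (f t)) @^-1` [set complex.Re z] `&`
  (fun t => complex.Im (f t)) @^-1` [set complex.Im z]).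
  by apply: measurableI; rewrite -[X in measurable X]setTI; [apply: mr|apply: mi].
apply/seteqP; split => t /=; first by move=> ->.
by case: (f t) => a b; case: z => a' b' /= [-> ->].
Qed.

Lemma measurable_unitary :
  measurable [set W : gate_space R | (W : qop R 2) \is unitarymx].
Proof.
pose F (W : gate_space R) : qop R 2 := (W : qop R 2) *m (W : qop R 2)^t*.
have mF : mxmeasurable F.
  by apply: mxmeasurableM; [|apply: mxmeasurable_adj]; exact: mxmeasurable_gate.
rewrite (_ : [set W | _] = \bigcap_(i in [set: 'I_#|bits 2|])
    \bigcap_(j in [set: 'I_#|bits 2|]) [set W | F W i j = (1%:M : qop R 2) i j]).
  apply: fin_bigcap_measurable => // i _; apply: fin_bigcap_measurable => // j _.
  exact: measurable_cpreimage1.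
apply/seteqP; split => [W /= /unitarymxP FW i _ j _|W H]; first by rewrite /= /F FW.
by apply/unitarymxP/matrixP => i j; exact: H.
Qed.

Variable I : finType.

(** The pi-system that generates the product sigma-algebra on families of gates. *)
Definition boxes : set (set (I -> gate_space R)) :=
  [set S | exists2 B : I -> set (gate_space R), forall i, measurable (B i) &
     S = [set u | forall i, B i (u i)]].

Definition gates_space := g_sigma_algebraType boxes.

Lemma measurable_box (B : I -> set (gate_space R)) : (forall i, measurable (B i)) ->
  measurable [set u : gates_space | forall i, B i (u i)].
Proof. by move=> mB; apply: sub_sigma_algebra; exists B. Qed.

Lemma measurable_gates_coordinate i : measurable_fun setT (fun u : gates_space => u i).
Proof.
move=> _ B mB; rewrite setTI.
rewrite (_ : _ @^-1` _ = [set u : gates_space |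
    forall k, (if k == i then B else setT) (u k)]).
  by apply: (@measurable_box (fun k => if k == i then B else setT)) => k; case: ifP.
apply/seteqP; split => u /= H; last by have := H i; rewrite eqxx.
by move=> k; case: eqP => [->|].
Qed.

Lemma mxmeasurable_gates i : mxmeasurable (fun u : gates_space => (u i : qop R 2)).
Proof.
move=> k l; have [mr mi] := mxmeasurable_gate k l; split.
  exact: measurableT_comp mr (measurable_gates_coordinate i).
exact: measurableT_comp mi (measurable_gates_coordinate i).
Qed.

Definition shift_gate (i0 : I) (V : qop R 2) (u : gates_space) : gates_space :=
  fun i => if i == i0 then V *m (u i : qop R 2) else u i.

Lemma measurable_mulgate (V : qop R 2) (B : set (gate_space R)) : measurable B ->
  measurable [set W : gate_space R | B (V *m (W : qop R 2))].
Proof.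
move=> mB; rewrite -[X in measurable X]setTI.
apply: (measurable_gate _ measurableT mB).
by apply: mxmeasurableM; [exact: mxmeasurable_cst|exact: mxmeasurable_gate].
Qed.

(** The preimage of a box under the shift is a box again; only its side at i0 changes. *)
Definition shift_sides i0 V (B : I -> set (gate_space R)) i : set (gate_space R) :=
  if i == i0 then [set W : gate_space R | B i (V *m (W : qop R 2))] else B i.

Lemma measurable_shift_sides i0 V (B : I -> set (gate_space R)) :
  (forall i, measurable (B i)) -> forall i, measurable (shift_sides i0 V B i).
Proof.
by move=> mB i; rewrite /shift_sides; case: ifP => // _; exact: measurable_mulgate.
Qed.

Lemma shift_gate_box i0 V (B : I -> set (gate_space R)) (u : gates_space) :
  (forall i, B i (shift_gate i0 V u i)) <-> forall i, shift_sides i0 V B i (u i).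
Proof.
by split=> H i; have := H i; rewrite /shift_sides/shift_gate; case: ifP.
Qed.

Lemma measurable_shift_gate i0 V : measurable_fun setT (shift_gate i0 V).
Proof.
apply: (@measurability _ _ gates_space gates_space setT (shift_gate i0 V) boxes erefl).
move=> _ [_ [B mB ->] <-]; rewrite setTI.
rewrite (_ : _ @^-1` _ = [set u : gates_space | forall i, shift_sides i0 V B i (u i)]).
  by apply: (@measurable_box (shift_sides i0 V B)); exact: measurable_shift_sides.
by apply/seteqP; split => u /=; rewrite shift_gate_box.
Qed.

Variables (d : measure_display) (Omega : measurableType d) (P : probability Omega R).
Variable U : I -> {RV P >-> gate_space R}.
Hypothesis Uindep : mutually_independent U.
Hypothesis Uhaar : forall g (B : set (gate_space R)), measurable B ->
  distribution P (U g) B = haar B.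

Definition joint (w : Omega) : gates_space := fun i => U i w.

Lemma joint_box (B : I -> set (gate_space R)) : (forall i, measurable (B i)) ->
  P [set w | forall i, B i (joint w i)] = (\prod_i haar (B i))%E.
Proof.
move=> mB; have := Uindep [set: I]%SET mB.
rewrite (_ : [set w | _] = [set w | forall i, B i (joint w i)]).
  by move=> ->; apply: eq_big => [i|i _]; [rewrite finset.in_setT|rewrite -(Uhaar i)].
by apply/seteqP; split => w /= H i => [|_]; apply: H; rewrite ?finset.in_setT.
Qed.

Lemma measurable_joint : measurable_fun setT joint.
Proof.
apply: (@measurability _ _ Omega gates_space setT joint boxes erefl).
move=> _ [_ [B mB ->] <-]; rewrite setTI.
rewrite (_ : _ @^-1` _ = \bigcap_(i in [set: I]) (U i @^-1` B i)).
  apply: fin_bigcap_measurable => // i _.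
  by rewrite -[X in measurable X]setTI; exact: measurable_funPT.
by apply/seteqP; split => w /= H => [i _|i]; exact: H.
Qed.

(** The Haar measure lives on all operators, so unitarity holds only almost surely: the box with all
    sides the unitary group has probability a product of ones. *)
Lemma ae_unitary : \forall w \ae P, forall i, (joint w i : qop R 2) \is unitarymx.
Proof.
pose G := [set w | forall i, (joint w i : qop R 2) \is unitarymx].
have mG : measurable G.
  rewrite -[X in measurable X]setTI.
  exact: (measurable_joint measurableT (@measurable_box
    (fun=> [set W : gate_space R | (W : qop R 2) \is unitarymx]) (fun=> measurable_unitary))).
have PG : P G = 1%E.
  rewrite (@joint_box (fun=> [set W : gate_space R | (W : qop R 2) \is unitarymx])).
    by rewrite big1// => i _; exact: haarP.1.
  by move=> i; exact: measurable_unitary.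
exists (~` G); split => //; first exact: measurableC.
by have := probability_setC P mG; rewrite PG subee.
Qed.

(** By independence and left invariance of the Haar measure, the shifted and the original family
    give every box the same probability. Boxes form a generating pi-system, so the two laws
    coincide. *)
Lemma integral_shift i0 (V : qop R 2) (phi : gates_space -> \bar R) :
  V \is unitarymx -> measurable_fun setT phi -> (forall u, 0 <= phi u)%E ->
  (\int[P]_w phi (shift_gate i0 V (joint w)) = \int[P]_w phi (joint w))%E.
Proof.
move=> Vu mphi phi0.
have msj : measurable_fun setT (shift_gate i0 V \o joint).
  by apply: measurableT_comp measurable_joint; exact: measurable_shift_gate.
pose Y : {RV P >-> gates_space} := HB.pack joint
  (@isMeasurableFun.Build _ _ _ _ joint measurable_joint).
pose X : {RV P >-> gates_space} := HB.pack (shift_gate i0 V \o joint)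
  (@isMeasurableFun.Build _ _ _ _ _ msj).
rewrite -[LHS](ge0_integral_distribution X mphi phi0).
rewrite -[RHS](ge0_integral_distribution Y mphi phi0).
apply: eq_measure_integral => A mA _.
apply: (@g_sigma_algebra_measure_unique _ R gates_space boxes _ (fun=> setT)
  _ _ (distribution P X) (distribution P Y)) => //.
- exact: sub_sigma_algebra.
- by move=> _; exists (fun=> setT) => //; apply/seteqP; split.
- by rewrite bigcup_const.
- move=> _ _ [B mB ->] [C mC ->]; exists (fun i => B i `&` C i).
    by move=> i; exact: measurableI.
  apply/seteqP; split => u /=; first by move=> [uB uC] i.
  by move=> H; split => i; have [] := H i.
- move=> _ [B mB ->]; rewrite -[RHS]/(P [set w | forall i, B i (joint w i)]).
  rewrite joint_box//.
  transitivity (P [set w | forall i, shift_sides i0 V B i (joint w i)]).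
    by congr (P _); apply/seteqP; split => w /=; rewrite shift_gate_box.
  rewrite joint_box; last exact: measurable_shift_sides.
  apply: eq_bigr => i _; rewrite /shift_sides; case: ifP => // _.
  by have [] := haarP.2 V (B i) Vu (mB i).
- by move=> _; apply: (le_lt_trans (probability_le1 (distribution P X) measurableT)); exact: ltry.
Qed.

End haar_gates.

(** * One random gate *)

Definition entry_norm (R : realType) n (X : 'M[R[i]]_n) : R :=
  \sum_i \sum_j modc (X i j).

Lemma entry_norm_ge0 (R : realType) n (X : 'M[R[i]]_n) : 0 <= entry_norm X.
Proof. by apply: sumr_ge0 => i _; apply: sumr_ge0 => j _; exact: modc_ge0. Qed.

Lemma modc_le_entry_norm (R : realType) n (X : 'M[R[i]]_n) i j : modc (X i j) <= entry_norm X.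
Proof.
rewrite /entry_norm (bigD1 i)//= (bigD1 j)//= -addrA lerDl addr_ge0//.
  by apply: sumr_ge0 => k _; exact: modc_ge0.
by apply: sumr_ge0 => k _; apply: sumr_ge0 => l _; exact: modc_ge0.
Qed.

(** Undoing the conjugation, each entry of X is a combination of the entries of V X V^* with
    coefficients of modulus at most 1, and X has n^2 entries. *)
Lemma entry_norm_unitary_conj (R : realType) n (V X : 'M[R[i]]_n) : V \is unitarymx ->
  entry_norm X <= n%:R ^+ 2 * entry_norm (V *m X *m V^t*).
Proof.
move=> Vu; set Y := V *m X *m V^t*.
have VV : V^t* *m V = 1%:M by rewrite -invmx_unitary// mulVmx// unitarymx_unit.
have XE : X = V^t* *m Y *m V.
  by rewrite /Y !mulmxA VV mul1mx -mulmxA VV mulmx1.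
have Xij i j : modc (X i j) <= entry_norm Y.
  rewrite {1}XE mxE; apply: (le_trans (modc_sum _ _ _)).
  rewrite /entry_norm exchange_big; apply: ler_sum => l _.
  rewrite mxE modcM -[leRHS]mulr1; apply: ler_pM; rewrite ?modc_ge0//; last first.
    exact: unitarymx_modc_le1.
  apply: (le_trans (modc_sum _ _ _)); apply: ler_sum => k _.
  by rewrite modcM ler_piMl ?modc_ge0// !mxE modc_conj unitarymx_modc_le1.
apply: (@le_trans _ _ (\sum_(i < n) \sum_(j < n) entry_norm Y)).
  by apply: ler_sum => i _; apply: ler_sum => j _.
by rewrite !sumr_const !card_ord -mulrnA -[leLHS]mulr_natl -natrX mulnn.
Qed.

Section expected_step.
Variables (R : realType) (haar : probability (gate_space R) R).
Hypothesis haarP : is_haar haar.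
Variables (I : finType) (d : measure_display) (Omega : measurableType d).
Variables (P : probability Omega R) (U : I -> {RV P >-> gate_space R}).
Hypothesis Uindep : mutually_independent U.
Hypothesis Uhaar : forall g (B : set (gate_space R)), measurable B ->
  distribution P (U g) B = haar B.

(** With W the gate at i0, domination is applied to X = W B W^*. Replacing W by V W turns X into V X
    V^* and leaves B fixed, so each term of the dominating sum is at most [f] at a shifted family,
    whose integral equals that of [f]. The constant collects the passage from B to X, the factor c
    and the number of unitaries. *)
Lemma expectation_step (i0 : I) (f : gates_space R I -> R) (B : gates_space R I -> qop R 2)
    (ell : qop R 2 -> R[i]) (Vs : seq (qop R 2)) (c : R) :
  measurable_fun setT f -> (forall u, 0 <= f u) -> mxmeasurable B ->
  (forall V u, B (shift_gate i0 V u) = B u) ->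
  (forall u : gates_space R I, (forall i, (u i : qop R 2) \is unitarymx) ->
     \tr (B u) = 0 /\
     modc (ell ((u i0 : qop R 2) *m B u *m (u i0 : qop R 2)^t*)) <= f u) ->
  {in Vs, forall V, V \is unitarymx} -> 0 <= c ->
  (forall X, \tr X = 0 ->
     entry_norm X <= c * \sum_(V <- Vs) modc (ell (V *m X *m V^t*))) ->
  (\int[P]_w (entry_norm (B (joint U w)))%:E <=
   (#|bits 2|%:R ^+ 2 * c * (size Vs)%:R)%:E * \int[P]_w (f (joint U w))%:E)%E.
Proof.
move=> mf f0 mB Bshift fB Vsu c0 dom.
have mj := measurable_joint U.
pose k := #|bits 2|%:R ^+ 2 * c.
have k0 : 0 <= k by rewrite mulr_ge0// sqr_ge0.
have mfs V : measurable_fun setT (fun w => (k * f (shift_gate i0 V (joint U w)))%:E).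
  apply/measurable_EFinP; apply: measurable_funM => //.
  apply: (measurableT_comp mf); apply: measurableT_comp mj.
  exact: measurable_shift_gate.
have mnB : measurable_fun setT (fun u => entry_norm (B u)).
  by apply: measurable_sum => i; apply: measurable_sum => j; exact: measurable_modc.
have step : (\int[P]_w (entry_norm (B (joint U w)))%:E <=
    \int[P]_w \sum_(V <- Vs) (k * f (shift_gate i0 V (joint U w)))%:E)%E.
  apply: ae_ge0_le_integral => //.
  - by move=> w _; rewrite lee_fin entry_norm_ge0.
  - exact/measurable_EFinP/(measurableT_comp mnB).
  - by move=> w _; apply: sume_ge0 => V _; rewrite lee_fin mulr_ge0.
  - exact: emeasurable_sum.
  have aeu := ae_unitary haarP Uindep Uhaar.
  apply: filterS aeu => w wu _.
  set u := joint U w in wu *.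
  have [B0 _] := fB u wu.
  set X := (u i0 : qop R 2) *m B u *m (u i0 : qop R 2)^t*.
  have X0 : \tr X = 0.
    rewrite /X mxtrace_mulC mulmxA -invmx_unitary// mulVmx ?unitarymx_unit//.
    by rewrite mul1mx.
  rewrite sumEFin lee_fin; apply: (le_trans (entry_norm_unitary_conj _ (wu i0))).
  apply: (le_trans (ler_wpM2l (sqr_ge0 _) (dom X X0))).
  rewrite mulrA -/k mulr_sumr !big_seq; apply: ler_sum => V VVs; rewrite ler_wpM2l//.
  (* The shifted family is unitary as well, so the bound by [f] is available there. *)
  have su i : (shift_gate i0 V u i : qop R 2) \is unitarymx.
    by rewrite /shift_gate; case: ifP => // _; apply: mul_unitarymx => //; exact: Vsu.
  have [_] := fB _ su; rewrite Bshift /shift_gate eqxx.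
  by rewrite trmx_mul map_mxM/= /X !mulmxA.
apply: (le_trans step); rewrite ge0_integral_sum//; last first.
  by move=> V w _; rewrite lee_fin mulr_ge0.
rewrite (eq_big_seq (fun=> k%:E * \int[P]_w (f (joint U w))%:E)%E); last first.
  move=> V VVs /=; rewrite -(integral_shift haarP Uindep Uhaar i0 (Vsu V VVs)
    (phi := fun u => (f u)%:E)).
  - rewrite -ge0_integralZl_EFin//.
      by move=> w _; rewrite lee_fin.
    apply/measurable_EFinP; apply: (measurableT_comp mf); apply: measurableT_comp mj.
    exact: measurable_shift_gate.
  - exact/measurable_EFinP.
  - by move=> u; rewrite lee_fin.
rewrite big_const_seq count_predT.
have J0 : (0 <= \int[P]_w (f (joint U w))%:E)%E.
  by apply: integral_ge0 => w _; rewrite lee_fin.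
rewrite le_eqVlt; apply/orP; left; apply/eqP.
elim: (size Vs) => [|s IHs]; first by rewrite mulr0 mul0e.
rewrite iterS IHs -ge0_muleDl ?lee_fin ?mulr_ge0// -EFinD.
by congr (_%:E * _)%E; rewrite -natr1 /k; ring.
Qed.

End expected_step.

(** * One layer *)

Section local_channel.
Variables (R : realType) (N : {linear qop R 2 -> qop R 2}).

Lemma noisy_gate_is_linear (W : qop R 2) : linear (noisy_gate N W).
Proof.
move=> a X Y; rewrite /noisy_gate mulmxDr mulmxDl -scalemxAr -scalemxAl.
by rewrite linearP.
Qed.

HB.instance Definition _ (W : qop R 2) :=
  GRing.isLinear.Build R[i] (qop R 2) (qop R 2) *:%R (noisy_gate N W)
    (noisy_gate_is_linear W).

Lemma noisy_gate_tp (W : qop R 2) : trace_preserving N -> W \is unitarymx ->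
  trace_preserving (noisy_gate N W).
Proof.
move=> Ntp Wu A; rewrite /noisy_gate Ntp mxtrace_mulC mulmxA -invmx_unitary//.
by rewrite mulVmx ?unitarymx_unit// mul1mx.
Qed.

(* The orientation o tells which of the two output qubits is kept. *)
Definition place_bits (o b e : bool) : bits 2 :=
  if o then pair_bits b e else pair_bits e b.

Definition kept_entry o b c (X : qop R 2) : R[i] :=
  \sum_e entry (N X) (place_bits o b e) (place_bits o c e).

Lemma kept_entry_traceE o b c : exists L : qop R 2,
  forall X, kept_entry o b c X = \tr (L *m X).
Proof.
(* The indices are exchanged because the trace of L E_lk is L_kl. *)
exists (\matrix_(k, l) kept_entry o b c (delta_mx l k)) => X.
rewrite /mxtrace; under eq_bigr do rewrite mxE; rewrite exchange_big/=.
transitivity (\sum_e \sum_k \sum_l X k l *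
    entry (N (delta_mx k l)) (place_bits o b e) (place_bits o c e)).
  by apply: eq_bigr => e _; exact: (linear_mxE N).
rewrite exchange_big; apply: eq_bigr => k _.
rewrite exchange_big; apply: eq_bigr => l _; rewrite mxE mulrC.
by rewrite /kept_entry mulr_sumr.
Qed.

Lemma kept_entryB o b c X Y :
  kept_entry o b c (X - Y) = kept_entry o b c X - kept_entry o b c Y.
Proof. by rewrite /kept_entry linearB -sumrB; apply: eq_bigr => e _; rewrite entryB. Qed.

Definition swap_bits (u : bits 2) : bits 2 := [ffun k => u (rev_ord k)].

Lemma swap_bitsK : involutive swap_bits.
Proof. by move=> u; apply/ffunP => k; rewrite !ffunE rev_ordK. Qed.

Lemma swap_place_bits o b e : swap_bits (place_bits o b e) = place_bits (~~ o) b e.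
Proof.
by apply/ffunP => k; rewrite /place_bits; case: o; rewrite !ffunE;
  case: k => -[|[|//]] ?.
Qed.

Lemma entry_swap_conj (X : qop R 2) u v :
  entry (swap_conj X) u v = entry X (swap_bits u) (swap_bits v).
Proof. exact: entry_mkop. Qed.

Lemma mxtrace_swap_conj (X : qop R 2) : \tr (swap_conj X) = \tr X.
Proof.
rewrite !mxtrace_entry [RHS](reindex_inj (inv_inj swap_bitsK))/=.
by apply: eq_bigr => u _; rewrite entry_swap_conj.
Qed.

Lemma kept_entry_swap o b c (X : qop R 2) : swap_symmetric N ->
  kept_entry o b c (swap_conj X) = kept_entry (~~ o) b c X.
Proof.
move=> Nsym; apply: eq_bigr => e _; rewrite Nsym entry_swap_conj.
by rewrite !swap_place_bits.
Qed.

(** The difference of two states with different local outputs is traceless and serves one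
    orientation; its swap conjugate serves the other with the same b and c, by the symmetry of N. *)
Lemma kept_entry_neq0 : swap_symmetric N -> retains_local_information N ->
  exists b c, forall o, exists2 X, \tr X = 0 & kept_entry o b c X != 0.
Proof.
move=> Nsym [rho [sigma [[_ tr1] [_ tr2] Nrs]]].
have [b [c bc]] : exists b c,
    entry (ptrace2 (N rho)) b c != entry (ptrace2 (N sigma)) b c.
  apply: contrapT => H; apply: Nrs; apply: opP => b c; apply/eqP.
  by apply: contra_notT H => bc; exists b, c.
exists b, c; have tr0 : \tr (rho - sigma) = 0 by rewrite linearB/= tr1 tr2 subrr.
have E X : kept_entry true b c X = entry (ptrace2 (N X)) b c by rewrite entry_mkop.
have X0 : kept_entry true b c (rho - sigma) != 0.
  by rewrite kept_entryB !E subr_eq0.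
case; first by exists (rho - sigma).
by exists (swap_conj (rho - sigma)); rewrite ?mxtrace_swap_conj// kept_entry_swap.
Qed.

(** A functional given by a scalar matrix vanishes on traceless operators, so the matrix of a kept
    entry is not scalar and irreducibility applies. *)
Lemma kept_entry_dominates : swap_symmetric N -> retains_local_information N ->
  exists b c, forall o, exists (Vs : seq (qop R 2)) (K : R),
    [/\ {in Vs, forall V, V \is unitarymx}, 0 <= K &
        forall X, \tr X = 0 -> entry_norm X <=
          K * \sum_(V <- Vs) modc (kept_entry o b c (V *m X *m V^t*))].
Proof.
move=> Nsym Ninf; have [b [c H]] := kept_entry_neq0 Nsym Ninf.
exists b, c => o; have [X0 trX0 nz] := H o.
have [L LE] := kept_entry_traceE o b c.
have Lc a : L <> a%:M.
  by move=> La; move: nz; rewrite LE La mul_scalar_mx mxtraceZ trX0 mulr0 eqxx.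
have [Vs [K [Vu K0 D]]] := dominated_entries Lc.
exists Vs, K; split => // X trX; apply: (le_trans (D X trX)); rewrite ler_wpM2l//.
by apply: ler_sum => V _; rewrite LE.
Qed.

End local_channel.

Section layers.
Variables (R : realType) (N : {linear qop R 2 -> qop R 2}).
Hypothesis Ntp : trace_preserving N.
Variables (n m : nat) (g : 'I_m -> 'I_n * 'I_n).
Hypothesis gP : (forall k, (g k).1 <> (g k).2) /\
  (forall q : 'I_n, exists! k : 'I_m, q = (g k).1 \/ q = (g k).2).

Definition run (W : 'I_m -> qop R 2) (s : seq 'I_m) (A : qop R n) : qop R n :=
  foldl (fun B k => on_pair (noisy_gate N (W k)) (g k) B) A s.

Lemma gate_neq k : (g k).1 != (g k).2.
Proof. by apply/eqP; exact: gP.1. Qed.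

Lemma gate_disjoint k k' q : q \in [:: (g k).1; (g k).2] -> k' != k ->
  (q != (g k').1) && (q != (g k').2).
Proof.
have [k0 [_ k0u]] := gP.2 q; have inP j : q \in [:: (g j).1; (g j).2] -> k0 = j.
  by rewrite !inE => /orP[] /eqP H; apply: k0u; [left|right].
move=> qk kk'; rewrite -negb_or; apply: contra kk' => qk'.
by rewrite -(inP k qk) -(inP k')// !inE.
Qed.

Lemma marginal_run W s S f h (A : qop R n) : (forall k, W k \is unitarymx) ->
  {in s, forall k, ~~ S (g k).1 && ~~ S (g k).2} ->
  marginal S f h (run W s A) = marginal S f h A.
Proof.
move=> Wu; elim: s A => //= k s IHs A H.
have /andP[S1 S2] := H k (mem_head _ _).
rewrite IHs => [|j js]; last by apply: H; rewrite inE js orbT.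
by rewrite marginal_on_pair//; [apply: noisy_gate_tp|apply: gate_neq].
Qed.

Lemma mxtrace_run W s (A : qop R n) : (forall k, W k \is unitarymx) ->
  \tr (run W s A) = \tr A.
Proof. by move=> Wu; rewrite !(mxtrace_marginal xpred0 xpred0) marginal_run. Qed.

(** The gates of a layer are disjoint, so those other than k0 act on traced-out qubits. *)
Lemma reduce_run W s k0 (A : qop R n) : (forall k, W k \is unitarymx) ->
  k0 \notin s -> reduce (g k0) (run W s A) = reduce (g k0) A.
Proof.
move=> Wu k0s; apply: opP => u v; rewrite !entry_mkop marginal_run// => k ks.
have kk0 : k0 != k by apply: contraNneq k0s => ->.
have d1 := @gate_disjoint k k0 (g k).1 (mem_head _ _) kk0.
have in2 : (g k).2 \in [:: (g k).1; (g k).2] by rewrite !inE eqxx orbT.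
have d2 := gate_disjoint in2 kk0.
by rewrite /= !negb_or d1 d2.
Qed.

(** Split the layer at the gate k0 that contains q. Later gates avoid q and leave its reduction
    alone; earlier gates avoid both qubits of k0 and leave the reduction to that pair alone. The bit
    o records whether q comes first in the gate. *)
Lemma marginal_layer q : exists k0 o, forall W (A : qop R n) b c,
  (forall k, W k \is unitarymx) ->
  marginal (pred1 q) (fun=> b) (fun=> c) (run W (enum 'I_m) A) =
  kept_entry N o b c (W k0 *m reduce (g k0) A *m (W k0)^t*) /\
  marginal (pred1 q) (fun=> b) (fun=> c) A =
  \sum_e entry (reduce (g k0) A) (place_bits o b e) (place_bits o c e).
Proof.
have [k0 [qk0 _]] := gP.2 q.
have qk0' : q \in [:: (g k0).1; (g k0).2].
  by rewrite !inE; case: qk0 => ->; rewrite eqxx ?orbT.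
have neq0 := gate_neq k0.
have [side gE] : exists o, forall b c (A : qop R n),
    marginal (pred1 q) (fun=> b) (fun=> c) A =
    \sum_e entry (reduce (g k0) A) (place_bits o b e) (place_bits o c e).
  case: qk0 => qE; [exists true|exists false] => b c A; rewrite /place_bits.
    by rewrite (@marginal1_reduce1 _ _ _ (g k0).2) qE// -surjective_pairing.
  by rewrite (@marginal1_reduce2 _ _ _ (g k0).1) qE 1?eq_sym// -surjective_pairing.
exists k0, side => W A b c Wu; split=> //.
have := enum_uniq 'I_m; have : k0 \in enum 'I_m by rewrite mem_enum.
case/splitPr => s1 s2; rewrite cat_uniq /= negb_or.
move=> /and3P[_ /andP[k0s1 _] /andP[k0s2 _]].
rewrite /run foldl_cat -/(run W s1 A) /= -/(run W s2 _).
rewrite marginal_run//; last first.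
  move=> k ks2; have kk0 : k != k0 by apply: contraNneq k0s2 => <-.
  by have := gate_disjoint qk0' kk0; rewrite /= !(eq_sym q).
rewrite gE.
rewrite (reduce_on_pair (noisy_gate N (W k0)) _ (gate_neq k0)).
rewrite (reduce_run A Wu k0s1).
by [].
Qed.

End layers.

(** * The circuit *)

Section circuits.
Variables (R : realType) (N : {linear qop R 2 -> qop R 2}).
Hypothesis Ntp : trace_preserving N.
Variables (n D m : nat) (gates : 'I_D -> 'I_m -> 'I_n * 'I_n).
Hypothesis gatesP : parallel gates.
Let I : finType := ('I_D * 'I_m)%type.

Definition run_layers (s : seq 'I_D) (A : qop R n) (u : gates_space R I) : qop R n :=
  foldl (fun B t => run N (gates t) (fun k => u (t, k)) (enum 'I_m) B) A s.

Lemma run_layers_rcons s t A u : run_layers (rcons s t) A u =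
  run N (gates t) (fun k => u (t, k)) (enum 'I_m) (run_layers s A u).
Proof. exact: foldl_rcons. Qed.

Lemma mxmeasurable_run_layers s A : mxmeasurable (run_layers s A).
Proof.
elim/last_ind: s => [|s t IHs]; first exact: mxmeasurable_cst.
rewrite (_ : run_layers _ _ = fun u =>
    run N (gates t) (fun k => u (t, k)) (enum 'I_m) (run_layers s A u)); last first.
  by apply/funext => u; exact: run_layers_rcons.
rewrite /run; elim: (enum 'I_m) (run_layers s A) IHs => [//|k ks IHk] F mF /=.
apply: (IHk (fun u => on_pair (noisy_gate N (u (t, k))) (gates t k) (F u))).
apply: mxmeasurable_noisy_on_pair => //; exact: mxmeasurable_gates.
Qed.

(** The layers in [s] read only gates of their own layers. *)
Lemma run_layers_shift s A t k V u : t \notin s ->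
  run_layers s A (shift_gate (t, k) V u) = run_layers s A u.
Proof.
elim/last_ind: s => [//|s t' IHs]; rewrite mem_rcons inE negb_or => /andP[tt' ts].
rewrite !run_layers_rcons IHs//; congr (run _ _ _ _ _).
apply/funext => j; rewrite /shift_gate; case: eqP => // -[t't _].
by rewrite t't eqxx in tt'.
Qed.

Lemma mxtrace_run_layers s A (u : gates_space R I) :
  (forall i, (u i : qop R 2) \is unitarymx) -> \tr (run_layers s A u) = \tr A.
Proof.
move=> uu; elim/last_ind: s => [//|s t IHs].
by rewrite run_layers_rcons (mxtrace_run Ntp (gatesP t)).
Qed.

Lemma qubit_norm_ge0 (q : 'I_n) (A : qop R n) : 0 <= qubit_norm q A.
Proof. by apply: sumr_ge0 => b _; apply: sumr_ge0 => c _; exact: modc_ge0. Qed.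

Lemma modc_marginal_le_qubit_norm (q : 'I_n) b c (A : qop R n) :
  modc (marginal (pred1 q) (fun=> b) (fun=> c) A) <= qubit_norm q A.
Proof.
rewrite /qubit_norm (bigD1 b)//= (bigD1 c)//= -addrA lerDl addr_ge0//.
  by apply: sumr_ge0 => *; exact: modc_ge0.
by apply: sumr_ge0 => *; apply: sumr_ge0 => *; exact: modc_ge0.
Qed.

End circuits.

(** [expectation_step] is applied to the gate meeting q, with [f] the norm after layer t and [B] the
    two-qubit reduction before it. K is fixed before n, the architecture and the probability space,
    as it comes from the domination constants of N alone. *)
Lemma layer_contraction (R : realType) (haar : probability (gate_space R) R)
    (N : {linear qop R 2 -> qop R 2}) :
  is_haar haar -> trace_preserving N -> swap_symmetric N ->
  retains_local_information N ->
  exists2 K : R, 1 <= K &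
    forall (n D m : nat) (gates : 'I_D -> 'I_m -> 'I_n * 'I_n), parallel gates ->
    forall (d : measure_display) (Omega : measurableType d) (P : probability Omega R)
      (U : 'I_D * 'I_m -> {RV P >-> gate_space R}),
      mutually_independent U ->
      (forall g (B : set (gate_space R)), measurable B ->
         distribution P (U g) B = haar B) ->
    forall (q : 'I_n) (A : qop R n) s t, \tr A = 0 -> t \notin s ->
      (\int[P]_w (qubit_norm q (run_layers N gates s A (joint U w)))%:E <=
       K%:E * \int[P]_w (qubit_norm q (run_layers N gates (rcons s t) A (joint U w)))%:E)%E.
Proof.
move=> haarP Ntp Nsym Ninf.
have [b [c H]] := kept_entry_dominates Nsym Ninf.
have [Vs1 [K1 [V1u K10 D1]]] := H true.
have [Vs0 [K0 [V0u K00 D0]]] := H false.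
(* The factor 8 counts the four entries of a one-qubit reduction, each a sum of two entries of the
   pair reduction. *)
pose Kc K (Vs : seq (qop R 2)) : R := 8 * (#|bits 2|%:R ^+ 2 * K * (size Vs)%:R).
have Kc_ge0 K (Vs : seq (qop R 2)) : 0 <= K -> 0 <= Kc K Vs.
  by move=> ?; rewrite /Kc !mulr_ge0// sqr_ge0.
(* The sum covers both orientations, and the summand 1 ensures K >= 1. *)
exists (1 + Kc K1 Vs1 + Kc K0 Vs0).
  by rewrite -addrA lerDl addr_ge0// Kc_ge0.
move=> n D m gates gatesP d Omega P U Uindep Uhaar q A s t trA ts.
have [k0 [side layer]] := marginal_layer Ntp (gatesP t) q.
have [Vs [K [Vu K_ge0 dom Kle]]] : exists (Vs : seq (qop R 2)) (K : R),
  [/\ {in Vs, forall V, V \is unitarymx}, 0 <= K,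
      forall X, \tr X = 0 -> entry_norm X <=
          K * \sum_(V <- Vs) modc (kept_entry N side b c (V *m X *m V^t*)) &
      Kc K Vs <= 1 + Kc K1 Vs1 + Kc K0 Vs0].
  have := Kc_ge0 _ Vs1 K10; have := Kc_ge0 _ Vs0 K00.
  by case: side {layer} => ? ?; [exists Vs1, K1|exists Vs0, K0]; split => //; lra.
pose f (u : gates_space R _) := qubit_norm q (run_layers N gates (rcons s t) A u).
pose B (u : gates_space R _) := reduce (gates t k0) (run_layers N gates s A u).
have mf : measurable_fun setT f.
  exact/measurable_qubit_norm/mxmeasurable_run_layers.
have mB : mxmeasurable B by exact/mxmeasurable_reduce/mxmeasurable_run_layers.
have f0 u : 0 <= f u := qubit_norm_ge0 _ _.
have neq : (gates t k0).1 != (gates t k0).2 by apply/eqP; exact: (gatesP t).1.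
have step := expectation_step haarP Uindep Uhaar (i0 := (t, k0)) (f := f) (B := B)
  (ell := kept_entry N side b c) mf f0 mB _ _ Vu K_ge0 dom.
have mj := measurable_joint U.
have leB u : qubit_norm q (run_layers N gates s A u) <= 8 * entry_norm (B u).
  have H1 b' c' : modc (marginal (pred1 q) (fun=> b') (fun=> c')
      (run_layers N gates s A u)) <= 2 * entry_norm (B u).
    have Wu (k : 'I_m) : (1%:M : qop R 2) \is unitarymx.
      by apply/unitarymxP; rewrite trmx1 map_mx1 mulmx1.
    (* The second half of [layer] concerns the operator before the layer, so any unitary gates can
       be supplied; identities are taken. *)
    have [_ ->] := layer (fun=> 1%:M : qop R 2) (run_layers N gates s A u) b' c' Wu.
    apply: (le_trans (modc_sum _ _ _)); rewrite big_bool/=.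
    rewrite (_ : 2 * _ = entry_norm (B u) + entry_norm (B u)); last by ring.
    by apply: lerD; exact: modc_le_entry_norm.
  rewrite /qubit_norm !big_bool/=.
  have := H1 true true; have := H1 true false; have := H1 false true.
  by have := H1 false false; lra.
have mnB : measurable_fun setT (fun u => entry_norm (B u)).
  by apply: measurable_sum => i; apply: measurable_sum => j; exact: measurable_modc.
apply: (@le_trans _ _ (\int[P]_w (8%:E * (entry_norm (B (joint U w)))%:E))%E).
  apply: ge0_le_integral_above => w; first by rewrite lee_fin qubit_norm_ge0.
  by rewrite -EFinM lee_fin.
rewrite ge0_integralZl_EFin//; last 2 first.
- by move=> w _; rewrite lee_fin entry_norm_ge0.
- exact/measurable_EFinP/(measurableT_comp mnB).
have J0 : (0 <= \int[P]_w (f (joint U w))%:E)%E.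
  by apply: integral_ge0 => w _; rewrite lee_fin.
apply: (@le_trans _ _ ((Kc K Vs)%:E * \int[P]_w (f (joint U w))%:E)%E); last first.
  by apply: lee_wpmul2r => //; rewrite lee_fin.
rewrite /Kc EFinM -muleA; apply: lee_wpmul2l; first by rewrite lee_fin.
apply: step => [V u|u uu]; first by rewrite /B run_layers_shift.
split; first by rewrite /B mxtrace_reduce// (mxtrace_run_layers Ntp gatesP).
have [<- _] := layer (fun k => u (t, k)) (run_layers N gates s A u) b c (fun k => uu (t, k)).
by rewrite /f run_layers_rcons; exact: modc_marginal_le_qubit_norm.
Qed.

(** * The exponential lower bound *)

Theorem theorem2 (R : realType) (haar : probability (gate_space R) R)
    (haarP : is_haar haar)
    (N : {linear qop R 2 -> qop R 2})
    (N_cp : completely_positive N) (N_tp : trace_preserving N)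
    (N_sym : swap_symmetric N) (N_inf : retains_local_information N) :
  exists2 Gamma : R, 0 < Gamma &
    forall (n D m : nat) (gates : 'I_D -> 'I_m -> 'I_n * 'I_n),
      parallel gates ->
    forall (d : measure_display) (Omega : measurableType d)
      (P : probability Omega R)
      (U : 'I_D * 'I_m -> {RV P >-> gate_space R}),
      mutually_independent U ->
      (forall g (B : set (gate_space R)), measurable B ->
         distribution P (U g) B = haar B) ->
    forall z z' : bits n, z <> z' ->
      ((expR (- Gamma * D%:R))%:E <=
       2^-1%:E * 'E_P[fun w => trace_norm
         (noisy_circuit N gates (fun g => U g w)
            (ketbra R z - ketbra R z')%R)])%E.
Proof.
  
have [K K1 step] := layer_contraction haarP N_tp N_sym N_inf.
have K8 : 1 < 8 * K by lra.
(* The target becomes (8K)^-D. The 8 is the 2 of the prefactor one half times the 4 of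
   [qubit_norm_le_trace_norm]; it is lost only once, and 8 K^D <= (8K)^D for D >= 1. *)
exists (ln (8 * K)); first exact: ln_gt0.
move=> n D m gates gatesP d Omega P U Uindep Uhaar z z' zz'.
have [q zq] : exists q, z q != z' q.
  apply: contrapT => H; apply: zz'; apply/ffunP => q; apply/eqP.
  by apply: contra_notT H => zq; exists q.
set A := (ketbra R z - ketbra R z')%R.
have trA : \tr A = 0 by rewrite /A linearB/= !mxtrace_ketbra subrr.
have cstE (r : R) : (\int[P]_w r%:E = r%:E)%E.
  by have := expectation_cst P r; rewrite unlock.
pose E s := (\int[P]_w (qubit_norm q (run_layers N gates s A (joint U w)))%:E)%E.
have E0 s : (0 <= E s)%E.
  by apply: integral_ge0 => w _; rewrite lee_fin qubit_norm_ge0.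
(* Induction on the layers applied, each costing one factor K; it starts from the one-qubit norm of
   the initial difference, which is at least 1. *)
have grow s : uniq s -> (1 <= (K ^+ size s)%:E * E s)%E.
  elim/last_ind: s => [_|s t IHs].
    rewrite expr0 mul1e.
    apply: (@le_trans _ _ (\int[P]_w 1%:E)%E).
      by rewrite cstE.
    apply: ge0_le_integral_above => w; first by rewrite lee_fin.
    by rewrite lee_fin; exact: qubit_norm_ketbra.
  rewrite rcons_uniq size_rcons => /andP[ts /IHs]; move/le_trans; apply.
  rewrite exprSr EFinM -muleA; apply: lee_wpmul2l.
    by rewrite lee_fin exprn_ge0//; lra.
  exact: (step _ _ _ _ gatesP).
rewrite unlock.
have circE w : noisy_circuit N gates (fun g => U g w) A =
   run_layers N gates (enum 'I_D) A (joint U w) by [].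
have expE : expR (- ln (8 * K) * D%:R) = ((8 * K) ^+ D)^-1.
  by rewrite mulNr expRN mulrC expRM_natl lnK// posrE; lra.
rewrite expE.
(* At depth zero the bound is exactly 1, so the trace norm of the initial difference is used
   directly. *)
have [D0|D0] := posnP D.
  rewrite {1}D0 expr0 invr1.
  rewrite (_ : 1%:E = 2^-1%:E * 2%:E)%E; last by rewrite -EFinM mulVf.
  apply: lee_wpmul2l; first by rewrite lee_fin.
  apply: (@le_trans _ _ (\int[P]_w 2%:E)%E).
    by rewrite cstE.
  apply: ge0_le_integral_above => w; first by rewrite lee_fin.
  rewrite lee_fin circE.
  have -> : enum 'I_D = [::] by apply: size0nil; rewrite size_enum_ord.
  by apply: trace_norm_ketbra; exact/eqP.
have := grow _ (enum_uniq 'I_D); rewrite size_enum_ord => gE.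
have KD : 0 < K ^+ D by rewrite exprn_gt0//; lra.
have K8D : 8 * K ^+ D <= (8 * K) ^+ D.
  rewrite exprMn ler_wpM2r ?(ltW KD)//.
  by rewrite -[leLHS]expr1 ler_weXn2l//; lra.
apply: (@le_trans _ _ ((8 * K ^+ D)^-1)%:E).
  rewrite lee_fin lef_pV2 ?posrE ?exprn_gt0 ?mulr_gt0 //; lra.
rewrite (_ : ((8 * K ^+ D)^-1)%:E = 2^-1%:E * (4^-1%:E * ((K ^+ D)^-1)%:E))%E; last first.
  by rewrite -!EFinM; congr _%:E; field; rewrite gt_eqF.
apply: lee_wpmul2l; first by rewrite lee_fin.
(* The growth estimate bounds the expected one-qubit norm below by K^-D; a quarter of that norm then
   bounds the trace norm from below pointwise. *)
apply: (@le_trans _ _ (4^-1%:E * E (enum 'I_D))%E).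
  apply: lee_wpmul2l; first by rewrite lee_fin.
  rewrite -[leLHS]mule1; apply: le_trans (lee_wpmul2l _ gE) _.
    by rewrite lee_fin invr_ge0 ltW.
  by rewrite muleA -EFinM mulVf ?gt_eqF// mul1e.
have mq : measurable_fun setT
    (fun u => qubit_norm q (run_layers N gates (enum 'I_D) A u)).
  exact/measurable_qubit_norm/mxmeasurable_run_layers.
rewrite /E -ge0_integralZl_EFin//; last 2 first.
- by move=> w _; rewrite lee_fin qubit_norm_ge0.
- exact/measurable_EFinP/(measurableT_comp mq)/measurable_joint.
apply: ge0_le_integral_above => w.
  by rewrite -EFinM lee_fin mulr_ge0 ?qubit_norm_ge0.
rewrite -EFinM lee_fin circE ler_pdivrMl//.
exact: qubit_norm_le_trace_norm.
Qed.
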